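(* Let $k$ be a field of prime characteristic $p>0$ with $[k:k^p]<\infty$, let $T=k[x_1,\dots,x_n]$ with the standard grading, let $J\subseteq T$ be a homogeneous ideal, let $S=T_{(x_1,\dots,x_n)}$, $I=JS$, and $R=S/I$. Let $\mathcal D$ be a Cartier subalgebra on $R$ such that every ideal $J_e^{\mathcal D}$ is (extended from) a homogeneous ideal. If $d_e=\mathrm d(J_e^{\mathcal D})$ satisfies $d_e=O(p^{te})$ as $e\to\infty$ for some fixed $t$, then $$\exp_F(\mathcal D)\le t\,\dim(R).$$
   Context: Generating degree. For a homogeneous ideal $\mathfrak b\subseteq T$, $\mathrm d(\mathfrak b)=\inf\{m\in\mathbb Z:\mathfrak b=\mathfrak b_{\le m}T\}$, the maximal degree of an element in a minimal set of homogeneous generators. For an ideal of $S$ of the form $\mathfrak bS$ with $\mathfrak b\subseteq T$ homogeneous (such $\mathfrak b$ is unique), $\mathrm d(\mathfrak bS)$ means $\mathrm d(\mathfrak b)$. For an ideal $\mathfrak b$, $\mathfrak b^{[p^e]}$ is the ideal generated by the $p^e$-th powers of its elements. Cartier subalgebras. For a ring $B$ of characteristic $p$, ${}^eB$ denotes $B$ viewed as a $B$-module via $r\cdot m=r^{p^e}m$. $\mathcal C_e^R=\operatorname{Hom}_R({}^eR,R)$ is the set of additive maps $\phi:R\to R$ with $\phi(r^{p^e}s)=r\phi(s)$; $\mathcal C^R=\bigoplus_{e\ge0}\mathcal C^R_e$ is a graded ring under composition with $\mathcal C_0^R=R$. A Cartier subalgebra on $R$ is a graded subring ($k$-subalgebra)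 $\mathcal D=\bigoplus_{e\ge 0}\mathcal D_e\subseteq\mathcal C^R$ with $\mathcal D_0=R$ and $\mathcal D_e\ne0$ for some $e>0$. The ideals $J_e^{\mathcal D}$. For each $e$, $\operatorname{Hom}_S({}^eS,S)$ is a cyclic module under premultiplication $(s\cdot\phi)(u)=\phi(su)$; fix a generator $\mathrm{Tr}$. By Fedder's lemma there is an isomorphism, $R$ acting by premultiplication on the target, $$\Psi:\frac{(I^{[p^e]}:I)}{I^{[p^e]}}\to\operatorname{Hom}_R({}^eR,R),\qquad \Psi(\overline s)=\overline{\mathrm{Tr}(s\cdot -)},$$ where the bar on the right denotes the map induced modulo $I$. $J_e^{\mathcal D}$ is the unique ideal of $S$ with $I^{[p^e]}\subseteq J_e^{\mathcal D}\subseteq(I^{[p^e]}:I)$ and $\Psi(J_e^{\mathcal D}/I^{[p^e]})=\mathcal D_e$. Frobenius exponent. For a graded ring $A=\bigoplus_{e\ge0}A_e$, not necessarily commutative, let $G_e(A)$ be the subring generated by elements of degree at most $e$ and $k_e(A)$ the minimal number of homogeneous generators of $G_e(A)$ as a ring over $A_0$ (elements of $A_0$ are not counted). The complexity of $A$ is $\mathrm{cx}(A)=\inf\{N\in\mathbb R_{>0}:k_e(A)-k_{e-1}(A)=O(N^e)\}$, and $\exp_F(\mathcal D)=\log_p(\mathrm{cx}(\mathcal D))$, with $\log_p0=-\infty$. *)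

(* Defs.v *)
From HB Require Import structures.
From mathcomp Require Import all_boot all_order all_algebra.
From mathcomp Require Import all_classical all_reals all_analysis.
(* The notations of mpoly clash with those of mathcomp-analysis. *)
From mathcomp Require mpoly.
Import (canonicals, coercions) mpoly.

Set Implicit Arguments.
Unset Strict Implicit.
Unset Printing Implicit Defensive.

Import Order.TTheory GRing.Theory Num.Theory.

Local Open Scope classical_set_scope.
Local Open Scope ring_scope.
Local Open Scope quotient_scope.

Section Ideals.
Variable A : comPzRingType.
Implicit Types (a b X P : set A).

(* The unit ideal is allowed, unlike in [idealr]. *)
Definition is_ideal a : Prop :=
  [/\ a 0, forall x y, a x -> a y -> a (x + y) & forall r x, a x -> a (r * x)].

Definition ideal_gen X : set A :=
  [set x | exists (m : nat) (r s : 'I_m -> A),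
     (forall i, X (s i)) /\ x = \sum_i r i * s i].

Definition colon a b : set A := [set s | forall x, b x -> a (s * x)].

Definition frob_power (p e : nat) a : set A :=
  ideal_gen [set x ^+ (p ^ e) | x in a].

Definition prime_ideal P : Prop :=
  [/\ is_ideal P, ~ P 1 & forall x y, P (x * y) -> P x \/ P y].

Definition prime_chain (m : nat) (c : nat -> set A) : Prop :=
  (forall i, (i <= m)%N -> prime_ideal (c i)) /\
  (forall i, (i < m)%N -> c i `<` c i.+1).

Definition krull_dim (rT : realType) : \bar rT :=
  ereal_sup [set (m%:R)%:E | m in [set m : nat | exists c, prime_chain m c]].

Lemma ideal_gen_is_ideal X : is_ideal (ideal_gen X).
Proof.
split.
- exists 0%N, (fun=> 0), (fun=> 0); split; first by case.
  by rewrite big_ord0.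
- move=> x y [m [r [s [Xs ->]]]] [m' [r' [s' [Xs' ->]]]].
  exists (m + m')%N,
    (fun i => match fintype.split i with inl j => r j | inr j => r' j end),
    (fun i => match fintype.split i with inl j => s j | inr j => s' j end); split.
    by move=> i; case: (fintype.split i).
  rewrite big_split_ord /=; congr (_ + _); apply: eq_bigr => i _.
    by rewrite (unsplitK (inl i)).
  by rewrite (unsplitK (inr i)).
- move=> t x [m [r [s [Xs ->]]]]; exists m, (fun i => t * r i), s; split=> //.
  by rewrite big_distrr /=; apply: eq_bigr => i _; rewrite mulrA.
Qed.

End Ideals.

Section QuotientRing.
Variables (A : comNzRingType) (X : set A).

Definition ideal_pred (x : A) : bool := `[< ideal_gen X x >].

Fact ideal_pred_zmod_closed : zmod_closed ideal_pred.
Proof.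
have [I0 ID IM] := ideal_gen_is_ideal X.
split=> [|x y /asboolP Ix /asboolP Iy]; first exact/asboolP.
by apply/asboolP/ID => //; rewrite -mulN1r; exact: IM.
Qed.

HB.instance Definition _ :=
  GRing.isZmodClosed.Build A ideal_pred ideal_pred_zmod_closed.

Definition ideal_closed : zmodClosed A :=
  GRing.ZmodClosed.clone A ideal_pred _.

(* A / (X).  The library's [{ideal_quot _}] is a ring only for proper ideals;
   here it is given its ring structure for every ideal. *)
Definition quotient_ring : Type := {ideal_quot ideal_closed}.

HB.instance Definition _ := GRing.Zmodule.on quotient_ring.

Definition quot_pi (x : A) : quotient_ring := \pi_({ideal_quot ideal_closed}) x.

Lemma quot_piP x y : (quot_pi x = quot_pi y) <-> ideal_gen X (x - y).
Proof.
split=> [/eqP h|h]; last first.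
  by apply/eqP; rewrite -Quotient.idealrBE; exact/asboolP.
have : \pi_({ideal_quot ideal_closed}) x == \pi_({ideal_quot ideal_closed}) y := h.
by rewrite -Quotient.idealrBE => /asboolP.
Qed.

Lemma quot_pi_surj (u : quotient_ring) : exists x, u = quot_pi x.
Proof. by exists (repr (u : {ideal_quot ideal_closed})); rewrite /quot_pi reprK. Qed.

Let rep (u : quotient_ring) : A := repr (u : {ideal_quot ideal_closed}).

Let repK u : quot_pi (rep u) = u. Proof. exact: reprK. Qed.

Definition quot_one : quotient_ring := quot_pi 1.
Definition quot_mul (u v : quotient_ring) : quotient_ring :=
  quot_pi (rep u * rep v).

Lemma quot_pi_mul x y : quot_pi (x * y) = quot_mul (quot_pi x) (quot_pi y).
Proof.
have [_ ID IM] := ideal_gen_is_ideal X.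
apply/quot_piP; set x' := rep _; set y' := rep _.
have hx : ideal_gen X (x - x') by apply/quot_piP; rewrite repK.
have hy : ideal_gen X (y - y') by apply/quot_piP; rewrite repK.
have -> : x * y - x' * y' = y * (x - x') + x' * (y - y').
  by rewrite !mulrBr [y * x]mulrC [y * x']mulrC addrA subrK.
by apply: ID; exact: IM.
Qed.

Lemma quot_pi_add x y : quot_pi (x + y) = quot_pi x + quot_pi y.
Proof. exact: (raddfD (\pi_({ideal_quot ideal_closed}))). Qed.

Fact quot_mulA : associative quot_mul.
Proof.
by move=> u v w; rewrite -(repK u) -(repK v) -(repK w) -!quot_pi_mul mulrA.
Qed.

Fact quot_mulC : commutative quot_mul.
Proof. by move=> u v; rewrite -(repK u) -(repK v) -!quot_pi_mul mulrC. Qed.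

Fact quot_mul1 : left_id quot_one quot_mul.
Proof. by move=> u; rewrite -(repK u) -quot_pi_mul mul1r. Qed.

Fact quot_mulD : left_distributive quot_mul +%R.
Proof.
move=> u v w; rewrite -(repK u) -(repK v) -(repK w).
by rewrite -quot_pi_add -!quot_pi_mul mulrDl quot_pi_add.
Qed.

HB.instance Definition _ := GRing.Zmodule_isComPzRing.Build quotient_ring
  quot_mulA quot_mulC quot_mul1 quot_mulD.

End QuotientRing.

Section Fractions.
Variable A : idomainType.
Local Notation tofrac := (@FracField.tofrac A).

Lemma tofrac_divB (f g f' g' : A) : g != 0 -> g' != 0 ->
  tofrac f / tofrac g - tofrac f' / tofrac g' =
  tofrac (f * g' - f' * g) / tofrac (g * g').
Proof.
move=> g0 g'0; rewrite -mulNr addf_div ?tofrac_eq0 //.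
by rewrite tofracB !tofracM mulNr.
Qed.

Lemma tofrac_divM (f g f' g' : A) :
  (tofrac f / tofrac g) * (tofrac f' / tofrac g') =
  tofrac (f * f') / tofrac (g * g').
Proof. by rewrite mulf_div !tofracM. Qed.

Lemma tofrac_div1 (f : A) : tofrac f = tofrac f / tofrac 1.
Proof. by rewrite tofrac1 divr1. Qed.

End Fractions.

Section Polynomials.
Variables (n : nat) (k : fieldType).
Local Notation T := (mpoly.mpoly n k).
Local Notation tofrac := (@FracField.tofrac T).

Definition homogeneous_ideal (a : set T) : Prop :=
  is_ideal a /\
  a = ideal_gen
        [set f | a f /\ exists d : nat, f \is mpoly.ishomog1 d (@mpoly.mdeg n)].

Definition degree_le (m : int) (f : T) : Prop :=
  forall u, u \in mpoly.msupp f -> ((mpoly.mdeg u)%:Z <= m)%R.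

(* d(0) = -oo. *)
Definition gen_degree (rT : realType) (a : set T) : \bar rT :=
  ereal_inf [set (m%:~R)%:E | m in
    [set m : int | a = ideal_gen [set f | a f /\ degree_le m f]]].

Definition irrelevant_ideal : set T :=
  ideal_gen [set mpoly.mpolyX k (mpoly.mnm1 i) | i in [set: 'I_n]].

Lemma irrelevantP (f : T) :
  irrelevant_ideal f <-> mpoly.mcoeff (@mpoly.mnm0 n) f = 0.
Proof.
have [I0 ID IM] := ideal_gen_is_ideal
  [set mpoly.mpolyX k (mpoly.mnm1 i) | i in [set: 'I_n]].
split=> [[m [r [s [Xs ->]]]]|f0].
  rewrite raddf_sum big1 //= => i _; rewrite rmorphM /=.
  have [j _ <-] := Xs i.
  by rewrite mpoly.mcoeffX mpoly.mnm1_eq0 mulr0.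
rewrite [f]mpoly.mpolyE; apply: (big_ind _ I0 ID) => u _.
rewrite -mpoly.mul_mpolyC; have [->|u0] := eqVneq u (@mpoly.mnm0 n).
  by rewrite f0 mul0r.
apply: (IM); have [i ui] : exists i : 'I_n, (0 < u i)%N.
  apply/existsP; apply: contra_neqT u0 => /existsPn h.
  by apply/mpoly.mnmP => i; rewrite mpoly.mnm0E; apply/eqP; rewrite -leqn0 leqNgt.
rewrite -(@mpoly.submK _ (mpoly.mnm1 i) u); last first.
  by rewrite mpoly.lep1mP -lt0n.
rewrite mpoly.mpolyXD; apply: IM.
exists 1%N, (fun=> 1), (fun=> mpoly.mpolyX k (mpoly.mnm1 i)); split.
  by move=> _; exists i.
by rewrite big_ord1 mul1r.
Qed.

Definition in_loc (x : {fraction T}) : bool :=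
  `[< exists f g : T, ~ irrelevant_ideal g /\ x = tofrac f / tofrac g >].

Lemma nirrelevant1 : ~ irrelevant_ideal (1 : T).
Proof. by move/irrelevantP/eqP; rewrite rmorph1 oner_eq0. Qed.

Lemma nirrelevantM (f g : T) :
  ~ irrelevant_ideal f -> ~ irrelevant_ideal g -> ~ irrelevant_ideal (f * g).
Proof.
rewrite !irrelevantP => /eqP f0 /eqP g0.
by rewrite rmorphM; apply/eqP; rewrite mulf_neq0.
Qed.

Lemma nirrelevant_neq0 (f : T) : ~ irrelevant_ideal f -> f != 0.
Proof. by rewrite irrelevantP => h; apply/eqP => f0; apply: h; rewrite f0 raddf0. Qed.

Fact in_loc_subring_closed : subring_closed in_loc.
Proof.
split=> [|x y /asboolP[f [g [hg ->]]] /asboolP[f' [g' [hg' ->]]]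
         |x y /asboolP[f [g [hg ->]]] /asboolP[f' [g' [hg' ->]]]];
  apply/asboolP.
- exists 1, 1; split; first exact: nirrelevant1.
  by rewrite -tofrac_div1 tofrac1.
- exists (f * g' - f' * g), (g * g'); split; first exact: nirrelevantM.
  by apply: tofrac_divB; exact: nirrelevant_neq0.
- exists (f * f'), (g * g'); split; first exact: nirrelevantM.
  exact: tofrac_divM.
Qed.

HB.instance Definition _ :=
  GRing.isSubringClosed.Build {fraction T} in_loc in_loc_subring_closed.

Record local_ring : Type := LocalRing {
  loc_val :> {fraction T};
  loc_valP : in_loc loc_val
}.

HB.instance Definition _ := [isSub for loc_val].
HB.instance Definition _ := [Choice of local_ring by <:].
HB.instance Definition _ :=
  [SubChoice_isSubComNzRing of local_ring by <:].

Lemma in_loc_tofrac (f : T) : in_loc (tofrac f).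
Proof.
apply/asboolP; exists f, 1; split; first exact: nirrelevant1.
exact: tofrac_div1.
Qed.

Definition loc_of (f : T) : local_ring := LocalRing (in_loc_tofrac f).

Definition extension (b : set T) : set local_ring := ideal_gen (loc_of @` b).

Definition quotient_local_ring (J : set T) : comPzRingType :=
  quotient_ring (loc_of @` J).

End Polynomials.

Section Cartier.
Variables (p : nat) (B : comPzRingType).

(* Hom_B(^e B, B). *)
Definition hom_frob (e : nat) : set (B -> B) :=
  [set f | (forall x y, f (x + y) = f x + f y) /\
           (forall r s, f (r ^+ (p ^ e) * s) = r * f s)].

Definition frob_generator (e : nat) (tr : B -> B) : Prop :=
  hom_frob e tr /\
  (forall f, hom_frob e f -> exists s, forall u, f u = tr (s * u)).

End Cartier.

(* A graded ring, or a graded subset of one, is given by the family of its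
   homogeneous components, all of which are subsets of a single additive group
   V; mul multiplies homogeneous elements and degrees are tracked by the index.
   The family generated below is that of the homogeneous components of the
   subring generated by the homogeneous elements X. *)
Section Graded.
Variables (V : zmodType) (one : V) (mul : V -> V -> V).
Implicit Types (A X : nat -> set V).

Definition graded_subring A : Prop :=
  [/\ forall i, A i 0,
      forall i x y, A i x -> A i y -> A i (x - y),
      A 0%N one &
      forall i j x y, A i x -> A j y -> A (i + j)%N (mul x y)].

Definition subring_gen X : nat -> set V :=
  fun i => [set x | forall A, graded_subring A ->
                    (forall j, X j `<=` A j) -> A i x].

Definition trunc_subring A (e : nat) : nat -> set V :=
  subring_gen (fun i => [set x | (i <= e)%N /\ A i x]).

(* G_e(A) is generated over A_0 by the m homogeneous elements v j of
   degree d j. *)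
Definition gen_by A (e m : nat) (d : 'I_m -> nat) (v : 'I_m -> V) : Prop :=
  trunc_subring A e =
  subring_gen (fun i => [set x | (i = 0%N /\ A 0%N x) \/
                                 exists j, d j = i /\ v j = x]).

Variable rT : realType.

(* +oo when there is no finite generating family. *)
Definition gen_number A (e : nat) : \bar rT :=
  ereal_inf [set (m%:R)%:E | m in
    [set m : nat | exists (d : 'I_m -> nat) (v : 'I_m -> V), gen_by A e d v]].

(* +oo - +oo = -oo, so the bound fails wherever gen_number is infinite. *)
Definition complexity A : \bar rT :=
  ereal_inf [set N%:E | N in [set N : rT | 0 < N /\
    exists C : rT, \forall e \near \oo,
      (`|gen_number A e - gen_number A e.-1| <= (C * N ^+ e)%:E)%E]].

Definition log_complexity (p : nat) A : \bar rT :=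
  (lne (complexity A) * ((ln p%:R)^-1)%:E)%E.

End Graded.

Section CartierAlgebra.
Variables (p : nat) (B : comPzRingType).

Definition cartier_subalgebra (D : nat -> set (B -> B)) : Prop :=
  [/\ forall e, D e `<=` hom_frob p e,
      graded_subring id (fun f g => f \o g) D,
      D 0%N = [set (fun x => r * x) | r in [set: B]] &
      exists2 e, (0 < e)%N & exists2 f, D e f & f <> 0].

Definition frob_exponent (rT : realType) (D : nat -> set (B -> B)) : \bar rT :=
  log_complexity id (fun f g => f \o g) rT p D.

End CartierAlgebra.

(* b is the ideal J_e^D for D_e = De, computed with the generator tr. *)
Definition fedder_ideal (A : comNzRingType) (X : set A) (p e : nat)
    (tr : A -> A) (De : set (quotient_ring X -> quotient_ring X))
    (b : set A) : Prop :=
  let I := ideal_gen X in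
  [/\ is_ideal b, frob_power p e I `<=` b, b `<=` colon (frob_power p e I) I &
      [set f : quotient_ring X -> quotient_ring X | exists2 s, b s &
         forall u, f (quot_pi X u) = quot_pi X (tr (s * u))] = De].

Definition F_finite (p : nat) (k : fieldType) : Prop :=
  exists (m : nat) (b : 'I_m -> k), forall a : k,
    exists c : 'I_m -> k, a = \sum_i c i ^+ p * b i.

(* Main.v *)
Require Import Defs.
From HB Require Import structures.
From mathcomp Require Import all_boot all_order all_algebra.
From mathcomp Require Import all_classical all_reals all_analysis.
From mathcomp Require Import zify ring lra.
From mathcomp Require mpoly.
Import (canonicals, coercions) mpoly.

Set Implicit Arguments.
Unset Strict Implicit.
Unset Printing Implicit Defensive.

Import Order.TTheory GRing.Theory Num.Theory.
Import -(notations) mpoly.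

Local Open Scope classical_set_scope.
Local Open Scope ring_scope.

(** Passing from [G_(e-1)(D)] to [G_e(D)] takes at most as many generators as the
    module [D_e] over [R], acting by premultiplication; by Fedder's lemma this is
    at most the number [mu_e] of generators of [J_e] modulo [I^[q]], where
    [q = p^e]. Conversely generators of degree [e] are useless in lower degrees, so
    [0 <= k_e - k_(e-1) <= mu_e], and the theorem follows from
    [mu_e = O(p^(t e dim R))].

    Write [J_e = b_e S]. Homogeneous ideals are contracted from [S]
    ([graded_contract]), so [J^[q] <= b_e <= (J^[q] : J)] already in [T], and [mu_e]
    is at most the dimension over [k] of the part of degree at most [d_e] of [b_e],
    modulo [J^[q]]. An element [f] of [(J^[q] : J)] acts as a map from [T / J] to
    [T / J^[q]], and it is determined modulo [J^[q]] by the traces over [k[X^q]] of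
    the products [f g], with [g] of degree at most [n q]. This bounds the dimension
    by [H(n q) H(d_e / q + n)], where [H] is the Hilbert function of [T / J]
    ([dim_le_colon]). Now [H(d)] is [O(d^D)] for the length [D] of some chain of
    homogeneous primes over [J] ([proper_graded_growth]), and such a chain survives
    in [R], so that [D <= dim R] ([krull_dim_ge]). Altogether
    [mu_e = O((d_e + q)^D)].

    If [J] is not zero, a comparison of lowest degrees shows [q <= d_e + 1]
    ([colon_frob_power_degree]); hence [mu_e = O(d_e^D)], and [t >= 0]. If [J = 0]
    and [t >= 0], then [H(d_e)] itself bounds [mu_e]. If [J = 0] and [t < 0], then
    [d_e <= 0] in large degrees, so [J_e] is [0] or [S]. Over the regular ring [S]
    the full modules [Hom(^e S, S)] multiply onto each other ([full_product]);
    therefore [D] is finitely generated and its exponent is [-oo]. *)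

(** * Dimension of subquotients *)

Section Dimension.
Variables (k : fieldType) (V : lmodType k).
Implicit Types U a : set V.

(** The dimension of [U / (U `&` a)] is at most [K], in a form that makes sense
    for subspaces of an infinite-dimensional space. *)
Definition dim_le U a (K : nat) : Prop :=
  exists (m : nat) (g : 'I_m -> V),
    [/\ (m <= K)%N, forall i, U (g i) &
        forall f, U f -> exists c : 'I_m -> k, a (f - \sum_i c i *: g i)].

Lemma dim_le_mono U a K K' : (K <= K')%N -> dim_le U a K -> dim_le U a K'.
Proof.
by move=> KK' [m [g [mK gU H]]]; exists m, g; split=> //; apply: leq_trans KK'.
Qed.

(** Take a matrix of largest rank among the row-free ones with rows in [W]. *)
Lemma rows_spanning K (W : set 'rV[k]_K) :
  exists (m : nat) (A : 'M[k]_(m, K)),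
    [/\ (m <= K)%N, forall i, W (row i A) & forall w, W w -> (w <= A)%MS].
Proof.
pose P m := `[< exists A : 'M[k]_(m, K), (forall i, W (row i A)) /\ row_free A >].
have P0 : exists m, P m.
  exists 0%N; apply/asboolP; exists 0; split; first by case.
  by rewrite /row_free mxrank0.
have Pb m : P m -> (m <= K)%N.
  by move=> /asboolP[A [_ /eqP <-]]; exact: rank_leq_col.
case: (ex_maxnP P0 Pb) => m /asboolP[A [AW Afree]] mmax.
exists m, A; split=> //; first by apply: Pb; apply/asboolP; exists A.
move=> w Ww; apply: contrapT => /negP wA.
have : P (m + 1)%N; last by move/mmax; rewrite addn1 ltnn.
apply/asboolP; exists (col_mx A w); split.
  move=> i; case: (split_ordP i) => j ->; rewrite ?rowKu ?rowKd; first exact: AW.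
  by rewrite ord1 row_id.
suff : (\rank A < \rank (A + w)%MS)%N.
  rewrite (eqP Afree) addsmxE /row_free eqn_leq rank_leq_row /=.
  by apply: leq_trans; rewrite addn1.
by rewrite (ltn_leqif (mxrank_leqif_sup (addsmxSl A w))) addsmx_sub submx_refl.
Qed.

(** [Rho f w] reads: [f] has coordinates [w] modulo [a]. It is a relation, since
    coordinates with respect to a spanning family are not unique. *)
Lemma dim_le_coord U a K (Rho : V -> 'rV[k]_K -> Prop) :
  (forall c f f' w w', Rho f w -> Rho f' w' -> Rho (f + c *: f') (w + c *: w')) ->
  (forall f, U f -> exists w, Rho f w) ->
  (forall f, Rho f 0 -> a f) -> dim_le U a K.
Proof.
move=> RhoL RhoT Rho0.
have [m [A [mK AW Aspan]]] := rows_spanning [set w | exists2 f, U f & Rho f w].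
have /choice[g Hg] : forall i, exists f, U f /\ Rho f (row i A).
  by move=> i; have [f Uf Rf] := AW i; exists f.
exists m, g; split=> //; first by move=> i; case: (Hg i).
move=> f Uf; have [w Rw] := RhoT f Uf.
have /Aspan/submxP[c wE] : [set w | exists2 f, U f & Rho f w] w by exists f.
exists (fun i => c 0 i); apply: Rho0.
have -> : 0 = w + (- 1) *: (\sum_i c 0 i *: row i A).
  by rewrite wE mulmx_sum_row scaleN1r subrr.
have : Rho (f - \sum_i c 0 i *: g i) (w + -1 *: \sum_i c 0 i *: row i A); last by [].
rewrite scaleN1r.
rewrite -!sumrN.
have aux (s : seq 'I_m) : Rho (f + \sum_(i <- s) - (c 0 i *: g i))
    (w + \sum_(i <- s) - (c 0 i *: row i A)).
  elim: s => [|i s IH]; first by rewrite !big_nil !addr0.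
  rewrite !big_cons ![- _ + _]addrC !addrA -!scaleNr.
  by apply: RhoL IH _; case: (Hg i).
exact: aux.
Qed.

Lemma dim_le_sub U U' a K :
  (forall c x y, a x -> a y -> a (x + c *: y)) ->
  U `<=` U' -> dim_le U' a K -> dim_le U a K.
Proof.
move=> aL UU' [m [g [mK gU gs]]]; apply: dim_le_mono mK _.
apply: (@dim_le_coord _ _ _ (fun f w => a (f - \sum_i w 0 i *: g i))).
- move=> c f f' w w' aw aw'.
  rewrite (_ : _ - _ = (f - \sum_i w 0 i *: g i) +
      c *: (f' - \sum_i w' 0 i *: g i)); first exact: aL.
  rewrite scalerBr addrACA -opprD; congr (_ - _).
  rewrite scaler_sumr -big_split /=; apply: eq_bigr => i _.
  by rewrite !mxE scalerDl scalerA.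
- move=> f /UU'/gs[c H]; exists (\row_i c i).
  by under eq_bigr do rewrite mxE.
- by move=> f; rewrite big1 ?subr0 // => i _; rewrite mxE scale0r.
Qed.

End Dimension.

(** * Homogeneous ideals *)

Section IdealClosure.
Variables (A : comPzRingType) (a : set A).
Hypothesis Ia : is_ideal a.

Lemma ideal0 : a 0. Proof. by case: Ia. Qed.

Lemma idealD x y : a x -> a y -> a (x + y). Proof. by case: Ia => _ + _; exact. Qed.

Lemma idealM r x : a x -> a (r * x). Proof. by case: Ia => _ _; exact. Qed.

Lemma idealMr r x : a x -> a (x * r). Proof. by rewrite mulrC; exact: idealM. Qed.

Lemma idealN x : a x -> a (- x). Proof. by rewrite -mulN1r; exact: idealM. Qed.

Lemma idealB x y : a x -> a y -> a (x - y).
Proof. by move=> ax ay; apply: idealD => //; exact: idealN. Qed.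

Lemma idealDl x y : a x -> a (x + y) -> a y.
Proof. by move=> ax axy; rewrite -(addKr x y) addrC; apply: idealB. Qed.

Lemma ideal_sum (I : Type) (s : seq I) (P : pred I) (F : I -> A) :
  (forall i, P i -> a (F i)) -> a (\sum_(i <- s | P i) F i).
Proof. by move=> H; apply: big_ind => //; [exact: ideal0 | exact: idealD]. Qed.

Lemma ideal_gen_sub (X : set A) : X `<=` a -> ideal_gen X `<=` a.
Proof.
by move=> Xa x [m [r [s [Xs ->]]]]; apply: ideal_sum => i _; apply/idealM/Xa/Xs.
Qed.

End IdealClosure.

Lemma sub_ideal_gen (A : comPzRingType) (X : set A) : X `<=` ideal_gen X.
Proof.
by move=> x Xx; exists 1%N, (fun=> 1), (fun=> x); split=> //; rewrite big_ord1 mul1r.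
Qed.

Lemma ideal_gen_mono (A : comPzRingType) (X Y : set A) :
  X `<=` ideal_gen Y -> ideal_gen X `<=` ideal_gen Y.
Proof. by move=> XY; apply: ideal_gen_sub => //; exact: ideal_gen_is_ideal. Qed.

Section GradedIdeals.
Variables (n : nat) (k : fieldType).
Local Notation T := (mpoly.mpoly n k).
Local Notation hc := (pihomog (@mdeg n)).
Local Notation homog d f := (f \is ishomog1 d (@mdeg n)).
Local Notation msize := (mmeasure (@mdeg n)).
Implicit Types (a : set T) (f g h : T).

(** Closure under homogeneous components, the form in which homogeneity is used
    below; see [homogeneous_graded]. *)
Definition graded a : Prop := is_ideal a /\ forall d f, a f -> a (hc d f).

Lemma graded_ideal a : graded a -> is_ideal a. Proof. by case. Qed.

Lemma gradedP a d f : graded a -> a f -> a (hc d f). Proof. by case=> _; exact. Qed.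

Lemma ideal_scale a c f : is_ideal a -> a f -> a (c *: f).
Proof. by move=> Ia af; rewrite -mul_mpolyC; exact: idealM. Qed.

Lemma ideal_lin a c f g : is_ideal a -> a f -> a g -> a (f + c *: g).
Proof. by move=> Ia af ag; apply: idealD => //; exact: ideal_scale. Qed.

Lemma mcoeff_hc d f u : mcoeff u (hc d f) = if mdeg u == d then mcoeff u f else 0.
Proof.
rewrite pihomogE [in RHS](mpolyE f) !raddf_sum /= big_mkcond.
case: ifP => ud; last first.
  apply: big1_seq => v _; case: ifP => // vd; rewrite mcoeffZ mcoeffX.
  by case: eqP => [vu|_]; rewrite ?mulr0 //; rewrite vu ud in vd.
apply: eq_bigr => v _; case: ifP => // vd; rewrite mcoeffZ mcoeffX.
by case: eqP => [vu|_]; rewrite ?mulr0 //; rewrite vu ud in vd.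
Qed.

Lemma hc_sum m f : (msize f <= m)%N -> f = \sum_(d < m) hc d f.
Proof. exact: pihomog_partitionE. Qed.

Lemma graded_mem a f : graded a -> (forall d, a (hc d f)) -> a f.
Proof.
move=> ga H; rewrite (hc_sum (leqnn (msize f))).
by apply: ideal_sum => //; exact: graded_ideal.
Qed.

(** Only the component of [h] in degree [d - e] can contribute. *)
Lemma hcMhomog d e g h : homog e g ->
  hc d (h * g) = if (e <= d)%N then hc (d - e) h * g else 0.
Proof.
move=> hg; rewrite {1}(hc_sum (leqnn (msize h))) mulr_suml raddf_sum /=.
have hcu (u : nat) :
    hc d (hc u h * g) = if (u + e == d)%N then hc u h * g else 0.
  have hug : homog (u + e) (hc u h * g) by apply: dhomogM => //; exact: pihomogP.
  case: eqP => [<-|/eqP ne]; first exact: pihomog_dE.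
  exact: pihomog_ne0 hug.
under eq_bigr do rewrite hcu.
case: leqP => ed; last first.
  by rewrite big1 // => u _; case: eqP => // E; rewrite -E ltnNge leq_addl in ed.
rewrite -big_mkcond /=; have [lt|ge] := ltnP (d - e) (msize h).
  rewrite (big_pred1 (Ordinal lt)) // => u /=.
  by rewrite -[in LHS](subnK ed) eqn_add2r.
rewrite big1 => [|u /eqP E]; last first.
  by move: ge; rewrite -E addnK leqNgt ltn_ord.
suff -> : hc (d - e) h = 0 by rewrite mul0r.
apply/mpolyP => u; rewrite mcoeff_hc mcoeff0; case: eqP => // ud.
by apply: memN_msupp_eq0; apply: (@mmeasure_mnm_ge _ _ (@mdeg n)); rewrite /= ud.
Qed.

Lemma hcM d f g : hc d (f * g) = \sum_(i < d.+1) hc i f * hc (d - i) g.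
Proof.
rewrite {1}(mpolyE f) mulr_suml raddf_sum /=.
under [RHS]eq_bigr => i _.
  rewrite [X in hc _ X](mpolyE f) raddf_sum mulr_suml /=; over.
rewrite exchange_big /=; apply: eq_bigr => u _.
rewrite -scalerAl linearZ /= mulrC (hcMhomog _ (e := mdeg u)); last first.
  by rewrite dhomogX.
under eq_bigr => i _.
  rewrite linearZ /= -scalerAl pihomogX /=; over.
rewrite -scaler_sumr; congr (_ *: _); case: leqP => ud.
  rewrite (bigD1 (Ordinal (n:=d.+1) (m:=mdeg u) ud)) //= eqxx big1 ?addr0 1?mulrC //.
  by move=> i; rewrite -val_eqE eq_sym /= => /negPf ->; rewrite mul0r.
rewrite big1 // => i _; case: eqP => [E|]; rewrite ?mul0r //.
by move: ud; rewrite E ltnNge -ltnS ltn_ord.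
Qed.

(** Comparing lowest terms modulo [a]: in degree [i + j] only the product of
    the two lowest surviving components of [f] and [g] is not already known to
    lie in [a]. *)
Lemma graded_lowest a i j f g : graded a -> a (f * g) ->
  (forall u, (u < i)%N -> a (hc u f)) -> (forall v, (v < j)%N -> a (hc v g)) ->
  a (hc i f * hc j g).
Proof.
move=> ga afg lf lg; have Ia := graded_ideal ga.
have := gradedP (i + j)%N ga afg; rewrite hcM.
have lti : (i < (i + j).+1)%N by rewrite ltnS leq_addr.
rewrite (bigD1 (Ordinal lti)) //= addKn addrC; apply: idealDl => //.
apply: ideal_sum => // u; rewrite -val_eqE /= neq_ltn => /orP[ui|iu].
  by apply: idealMr => //; exact: lf.
apply: idealM => //; apply: lg.
by rewrite ltn_subLR ?ltn_add2r // -ltnS ltn_ord.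
Qed.

Lemma graded_min a f : graded a -> ~ a f ->
  exists2 i, ~ a (hc i f) & forall u, (u < i)%N -> a (hc u f).
Proof.
move=> ga naf.
have ex : exists i, ~~ `[< a (hc i f) >].
  apply: contrapT => H; apply: naf; apply: graded_mem => // d.
  by apply: contrapT => nd; apply: H; exists d; apply/asboolP.
case: (ex_minnP ex) => i /asboolP nai imin; exists i => // u ui.
apply: contrapT => nau; have := imin u; rewrite leqNgt ui.
by move=> /(_ (introT (asboolPn _) nau)).
Qed.

Lemma hc0 f : hc 0 f = mpolyC n (mcoeff (@mnm0 n) f).
Proof.
apply/mpolyP => u; rewrite mcoeff_hc mcoeffC mdeg_eq0 eq_sym.
by case: eqP => [<-|]; rewrite ?mulr1 ?mulr0.
Qed.

(** A homogeneous ideal is contracted from the local ring at the origin: the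
    lowest term of a multiplier outside the maximal ideal is a non-zero constant. *)
Lemma graded_contract a f g : graded a -> ~ @irrelevant_ideal n k g ->
  a (f * g) -> a f.
Proof.
move=> ga gm afg; apply: contrapT => /(graded_min ga)[i nai lf].
apply: nai; have Ia := graded_ideal ga.
have := graded_lowest ga afg lf (fun v (v0 : (v < 0)%N) => ltac:(by [])).
rewrite hc0 mulrC mul_mpolyC => /(ideal_scale (mcoeff (@mnm0 n) g)^-1 Ia).
by rewrite scalerA mulVf ?scale1r //; apply/eqP => /irrelevantP.
Qed.

(** Primality of a homogeneous ideal may be tested on homogeneous elements, by
    passing to the lowest components outside the ideal. *)
Lemma graded_prime a : graded a -> ~ a 1 ->
  (forall i j f g, homog i f -> homog j g -> a (f * g) -> a f \/ a g) ->
  prime_ideal a.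
Proof.
move=> ga a1 H; split=> //; first exact: graded_ideal.
move=> f g afg; apply: contrapT => /not_orP[].
move=> /(graded_min ga)[i naf lf] /(graded_min ga)[j nag lg].
have [] := H _ _ _ _ (pihomogP _ i f) (pihomogP _ j g) => //.
exact: graded_lowest.
Qed.

Lemma ideal_gen_graded (X : set T) :
  (forall f, X f -> exists d, homog d f) -> graded (ideal_gen X).
Proof.
move=> XH; have IX := ideal_gen_is_ideal X; split=> // d f [m [r [s [Xs ->]]]].
rewrite raddf_sum /=; apply: ideal_sum => // i _.
have [e he] := XH _ (Xs i); rewrite (hcMhomog _ _ he); case: leqP => _.
  by apply: idealM => //; exact: sub_ideal_gen.
exact: ideal0.
Qed.

Lemma homogeneous_graded a : homogeneous_ideal a -> graded a.
Proof. by move=> [_ ->]; apply: ideal_gen_graded => f [_]. Qed.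

Lemma graded_proper a f : graded a -> ~ a 1 -> a f -> @irrelevant_ideal n k f.
Proof.
move=> ga a1 af; apply: contrapT => fm; apply: a1.
by apply: (graded_contract ga fm); rewrite mul1r.
Qed.

Lemma irrelevant_graded : graded (@irrelevant_ideal n k).
Proof.
by apply: ideal_gen_graded => f [i _ <-]; exists 1%N; rewrite dhomogX /= mdeg1.
Qed.

Definition adjoin a g : set T := [set f | exists y h, a y /\ f = y + h * g].

Definition colon_elt a g : set T := [set f | a (f * g)].

Lemma adjoin_sub a g : a `<=` adjoin a g.
Proof. by move=> f af; exists f, 0; rewrite mul0r addr0. Qed.

Lemma adjoin_mem a g : is_ideal a -> adjoin a g g.
Proof. by move=> Ia; exists 0, 1; rewrite mul1r add0r; split=> //; exact: ideal0. Qed.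

Lemma adjoin_graded a d g : graded a -> homog d g -> graded (adjoin a g).
Proof.
move=> ga hg; have Ia := graded_ideal ga; split; first split.
- by apply: adjoin_sub; exact: ideal0.
- move=> _ _ [y [h [ay ->]]] [y' [h' [ay' ->]]].
  by exists (y + y'), (h + h'); rewrite mulrDl addrACA; split=> //; exact: idealD.
- move=> r _ [y [h [ay ->]]]; exists (r * y), (r * h).
  by rewrite mulrDr mulrA; split=> //; exact: idealM.
- move=> e _ [y [h [ay ->]]]; exists (hc e y).
  rewrite raddfD /= (hcMhomog _ _ hg); case: leqP => _.
    by exists (hc (e - d) h); split=> //; exact: gradedP.
  by exists 0; rewrite mul0r; split=> //; exact: gradedP.
Qed.

Lemma adjoin_proper a g : graded a -> ~ a 1 -> @irrelevant_ideal n k g ->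
  ~ adjoin a g 1.
Proof.
move=> ga a1 mg [y [h [ay E]]]; apply: (@nirrelevant1 n k); rewrite E.
have Im := graded_ideal irrelevant_graded.
by apply: idealD => //; [exact: graded_proper ay | exact: idealM].
Qed.

Lemma colon_elt_sub a g : is_ideal a -> a `<=` colon_elt a g.
Proof. by move=> Ia f af; exact: idealMr. Qed.

Lemma colon_elt_graded a d g : graded a -> homog d g -> graded (colon_elt a g).
Proof.
move=> ga hg; have Ia := graded_ideal ga; split; first split.
- by rewrite /colon_elt/= mul0r; exact: ideal0.
- by move=> x y; rewrite /colon_elt/= mulrDl; exact: idealD.
- by move=> r x; rewrite /colon_elt/= -mulrA; exact: idealM.
- move=> e f; rewrite /colon_elt/= => /(gradedP (e + d) ga).
  by rewrite (hcMhomog _ _ hg) leq_addl addnK.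
Qed.

(** The bound on the degree is strict, which makes [low 0] the zero space and lets
    truncated subtraction of degrees behave well. *)
Definition low (d : nat) : set T := [set f | (msize f <= d)%N].

Lemma low_lin d c f g : low d f -> low d g -> low d (f + c *: g).
Proof.
rewrite /low/= => lf lg; apply: leq_trans (mmeasureD_le _ _ _) _.
by rewrite geq_max lf (leq_trans (mmeasureZ_le _ _ _) lg).
Qed.

Lemma low0 d : low d 0. Proof. by rewrite /low/= mmeasure0. Qed.

Lemma low_sum d (I : Type) (s : seq I) (P : pred I) F :
  (forall i, P i -> low d (F i)) -> low d (\sum_(i <- s | P i) F i).
Proof.
move=> H; apply: big_ind => //; first exact: low0.
by move=> f g lf lg; rewrite -(scale1r g); exact: low_lin.
Qed.

Lemma low_homog d e f : homog e f -> (e < d)%N -> low d f.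
Proof.
move=> hf ed; have [->|f0] := eqVneq f 0; first exact: low0.
by rewrite /low/= -(mlead_deg f0) (dhomogP _ _ _ hf _ (mlead_supp f0)).
Qed.

Definition trunc d f : T := \sum_(i < d) hc i f.

Lemma low_trunc d f : low d (trunc d f).
Proof. by apply: low_sum => i _; apply: low_homog (pihomogP _ i f) (ltn_ord i). Qed.

Lemma trunc_id d f : low d f -> trunc d f = f.
Proof. by move=> lf; rewrite /trunc -hc_sum. Qed.

Lemma truncMhomog d e g h : homog e g -> trunc d (h * g) = trunc (d - e) h * g.
Proof.
move=> hg; rewrite /trunc mulr_suml.
under eq_bigr do rewrite (hcMhomog _ _ hg).
have [ed|/ltnW de] := leqP e d; last first.
  rewrite (eqP (de : (d - e == 0)%N)) big_ord0 big1 // => i _.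
  by rewrite leqNgt (leq_trans (ltn_ord i) de).
rewrite -[in LHS](subnKC ed) big_split_ord /= big1 ?add0r => [|i _]; last first.
  by rewrite leqNgt ltn_ord.
by apply: eq_bigr => i _; rewrite leq_addr addKn.
Qed.

(** The exact sequence
    [0 -> T / (a : g) (- deg g) -> T / a -> T / (a + (g)) -> 0],
    with degrees truncated. *)
Lemma dim_le_exact a d e g K K' : graded a -> homog e g ->
  dim_le (low d) (adjoin a g) K -> dim_le (low (d - e)) (colon_elt a g) K' ->
  dim_le (low d) a (K + K').
Proof.
move=> ga hg [m [v [mK lv vs]]] [m' [v' [mK' lv' vs']]].
have Ia := graded_ideal ga.
exists (m + m')%N, (fun i => match fintype.split i with
   inl j => v j | inr j => trunc d (v' j * g) end); split.
- by rewrite leq_add.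
- by move=> i; case: (fintype.split i) => j //; exact: low_trunc.
move=> f lf; have [c Hc] := vs f lf; set w := f - _ in Hc.
have lw : low d w.
  rewrite /w -sumrN; rewrite -[X in _ + X]scale1r; apply: low_lin => //.
  by apply: low_sum => i _; rewrite -scaleNr -[_ *: _]add0r; apply: low_lin; [exact: low0|].
move: Hc => [y [h [ay wE]]].
have wE' : w = trunc d y + trunc (d - e) h * g.
  by rewrite -(truncMhomog _ _ hg) -{1}(trunc_id lw) wE /trunc -big_split /=;
     apply: eq_bigr => i _; rewrite raddfD.
have aty : a (trunc d y).
  by apply: ideal_sum => // i _; exact: gradedP.
have [c' Hc'] := vs' _ (low_trunc (d - e) h).
exists (fun i => match fintype.split i with inl j => c j | inr j => c' j end).
rewrite big_split_ord /=.
rewrite (eq_bigr (fun i => c i *: v i)) => [|i _]; last first.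
  by rewrite (unsplitK (inl i)).
rewrite [X in _ - (_ + X)](eq_bigr (fun i => (c' i *: v' i) * g)) => [|i _]; last first.
  by rewrite (unsplitK (inr i)) (truncMhomog _ _ hg) trunc_id ?scalerAl.
rewrite -mulr_suml opprD addrA -/w wE' -addrA -mulrBl.
exact: idealD.
Qed.

Lemma dim_le_irrelevant d : dim_le (low d) (@irrelevant_ideal n k) 1.
Proof.
apply: (@dim_le_sub _ _ _ setT) => //.
  by move=> c x y; apply: ideal_lin; exact: graded_ideal irrelevant_graded.
exists 1%N, (fun=> 1); split=> // f _; exists (fun=> mcoeff (@mnm0 n) f).
by apply/irrelevantP; rewrite big_ord1 raddfB /= mcoeffZ mcoeff1 eqxx mulr1 subrr.
Qed.

End GradedIdeals.

(** * Noetherianity and growth of Hilbert functions *)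

(** Keep jumping to a place where the minimum of the remaining values is attained. *)
Lemma monotone_subsequence (f : nat -> nat) :
  exists phi : nat -> nat, (forall i, (phi i < phi i.+1)%N) /\
    forall i, (f (phi i) <= f (phi i.+1))%N.
Proof.
have /choice[g Hg] : forall N, exists j, (N <= j)%N /\
    forall l, (N <= l)%N -> (f j <= f l)%N.
  move=> N; have ex : exists v, `[< exists2 j, (N <= j)%N & f j = v >].
    by exists (f N); apply/asboolP; exists N.
  case: (ex_minnP ex) => v /asboolP[j Nj <-] vmin; exists j; split=> // l Nl.
  by apply: vmin; apply/asboolP; exists l.
pose phi := fix phi i := if i is j.+1 then g (phi j).+1 else g 0%N.
have phi_lt i : (phi i < phi i.+1)%N by case: (Hg (phi i).+1).
exists phi; split=> // -[|i] /=.
  by case: (Hg 0%N) => _; apply.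
case: (Hg (phi i).+1) => H1; apply.
by case: (Hg (g (phi i).+1).+1) => + _; apply: leq_trans; apply: leqW.
Qed.

Lemma nat_seq_mono (s : nat -> nat) : (forall i, (s i <= s i.+1)%N) ->
  forall i j, (i <= j)%N -> (s i <= s j)%N.
Proof.
by move=> H; apply: (homo_leq (r := fun x y => is_true (x <= y)%N)) => // y x z;
   exact: leq_trans.
Qed.

Lemma leq_exp_base m m' e : (m <= m')%N -> (m ^ e <= m' ^ e)%N.
Proof. by case: e => // e; rewrite leq_exp2r. Qed.

(** Dickson's lemma: thin out the sequence one variable at a time, until every
    exponent is nondecreasing along it. *)
Lemma dickson (n : nat) (s : nat -> multinom n) :
  exists i j, (i < j)%N /\ forall v, (s i v <= s j v)%N.
Proof.
suff [phi [phi_lt phi_mono]] : exists phi : nat -> nat,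
    (forall i, (phi i < phi i.+1)%N) /\
    forall i v, v \in enum 'I_n -> (s (phi i) v <= s (phi i.+1) v)%N.
  by exists (phi 0%N), (phi 1%N); split=> // v; apply: phi_mono; rewrite mem_enum.
elim: (enum 'I_n) => [|v vs [phi [phi_lt IH]]]; first by exists id.
have [psi [psi_lt psi_mono]] := monotone_subsequence (fun i => s (phi i) v).
have phi_homo := nat_seq_mono (fun i => ltnW (phi_lt i)).
exists (phi \o psi); split=> [i /=|i w].
  apply: leq_trans (phi_lt _) _; exact: phi_homo.
rewrite inE => /predU1P[->|wvs]; first exact: psi_mono.
apply: (nat_seq_mono (s := fun i => s (phi i) w)) => //.
  by move=> j; exact: IH.
exact: ltnW.
Qed.

Section Noetherian.
Variables (n : nat) (k : fieldType).
Local Notation T := (mpoly.mpoly n k).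
Implicit Types (a b : set T) (f g h : T).

Lemma minimal_lead (P : T -> Prop) f : P f ->
  exists2 g, P g & forall h, P h -> ~~ (mlead h < mlead g)%O.
Proof.
move: {2}(mlead f) (erefl (mlead f)) => u; move: u f.
apply: (well_founded_ind (@ltom_wf n)) => u IH f fu Pf.
have [[h [Ph hu]]|nh] := pselect (exists h, P h /\ (mlead h < u)%O).
  exact: IH hu h erefl Ph.
exists f => // h Ph; apply/negP => hf; apply: nh; exists h.
by rewrite -fu.
Qed.

(** Choose [f_i] in [a_(i+1)] outside [a_i] with least leading monomial. Some
    leading monomial divides a later one, and then the later [f_j] can be reduced
    by a multiple of [f_i], against its minimality. *)
Lemma no_ascending_ideals (a : nat -> set T) :
  (forall i, is_ideal (a i)) -> ~ (forall i, a i `<` a i.+1).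
Proof.
move=> Ia asc.
have /choice[f Hf] : forall i, exists f, (a i.+1 f /\ ~ a i f) /\
    forall h, a i.+1 h -> ~ a i h -> ~~ (mlead h < mlead f)%O.
  move=> i; have [_ /nonsubset[g [g1 g0]]] := asc i.
  have [f Pf fmin] := @minimal_lead (fun f => a i.+1 f /\ ~ a i f) g (conj g1 g0).
  by exists f; split=> // h h1 h0; exact: fmin.
have a_mono i j : (i <= j)%N -> a i `<=` a j.
  elim: j => [|j IH]; first by rewrite leqn0 => /eqP->.
  rewrite leq_eqVlt => /predU1P[->//|/IH]; move/subset_trans; apply.
  by case: (asc j).
have f_neq0 i : f i != 0.
  by apply/eqP => E; case: (Hf i) => -[_ +] _; rewrite E; apply; exact: ideal0.
have [i [j [ij le_ij]]] := dickson (fun i => mlead (f i)).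
have [[fj1 fj0] jmin] := Hf j; have [[fi1 fi0] _] := Hf i.
pose u := mnm_sub (mlead (f j)) (mlead (f i)).
have uE : mnm_add u (mlead (f i)) = mlead (f j).
  by apply: submK; apply/mnm_lepP.
pose c := mcoeff (mlead (f j)) (f j) / mcoeff (mlead (f i)) (f i).
have c0 : c != 0 by rewrite mulf_neq0 ?invr_eq0 ?mleadc_eq0.
pose q := c *: (mpolyX k u * f i).
have X0 : mpolyX k u != 0.
  by apply/eqP => /(congr1 (mcoeff u)); rewrite mcoeffX eqxx mcoeff0 => /eqP;
     rewrite oner_eq0.
have qlead : mlead q = mlead (f j).
  by rewrite /q mleadZ // mleadM // mleadXm uE.
have aq : a j q.
  rewrite /q -mul_mpolyC; do 2 (apply: idealM => //).
  exact: a_mono fi1.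
have g1 : a j.+1 (f j - q).
  by apply: idealB => //; apply: a_mono aq.
have g0 : ~ a j (f j - q).
  by move=> ajg; apply: fj0; rewrite -(subrK q (f j)); apply: idealD.
have gneq0 : f j - q != 0.
  by apply/eqP => E; apply: g0; rewrite E; exact: ideal0.
have := jmin _ g1 g0; apply/negP; rewrite negbK lt_neqAle; apply/andP; split.
  apply: contra_neq gneq0 => E; apply/eqP; rewrite -mleadc_eq0 E mcoeffB /q mcoeffZ.
  by rewrite [mpolyX _ _ * _]mulrC -[in X in _ - _ * X]uE mcoeffMX /c divfK ?subrr // mleadc_eq0.
by apply: le_trans (mleadB_le _ _) _; rewrite qlead joinxx.
Qed.

Lemma ideal_noetherian_ind (P : set T -> Prop) :
  (forall a, is_ideal a -> (forall b, is_ideal b -> a `<` b -> P b) -> P a) ->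
  forall a, is_ideal a -> P a.
Proof.
move=> step a Ia; apply: contrapT => nPa.
pose bad := {b : set T | is_ideal b /\ ~ P b}.
have /choice[nxt Hnxt] : forall b : bad, exists b' : bad, sval b `<` sval b'.
  move=> [b [Ib nPb]] /=; apply: contrapT => H; apply: nPb; apply: step => // b' Ib' bb'.
  by apply: contrapT => nPb'; apply: H; exists (exist _ b' (conj Ib' nPb')).
pose s i := iter i nxt (exist _ a (conj Ia nPa)).
apply: (@no_ascending_ideals (fun i => sval (s i))) => i; last exact: Hnxt.
by case: (s i) => b [].
Qed.

(** Hilbert's basis theorem: keep adjoining an element of [b] that is not yet
    generated. *)
Lemma ideal_finitely_generated b : is_ideal b ->
  exists s : seq T, b = ideal_gen [set f | f \in s].
Proof.
move=> Ib; suff H a : is_ideal a -> forall s : seq T,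
    a = ideal_gen [set f | f \in s] -> [set f | f \in s] `<=` b ->
    exists s : seq T, b = ideal_gen [set f | f \in s].
  by apply: (H _ (ideal_gen_is_ideal [set f | f \in [::]]) [::]).
move: a; apply: ideal_noetherian_ind => a Ia IH s aE sb.
have ab : a `<=` b by rewrite aE; exact: ideal_gen_sub.
have [ba|/nonsubset[x [bx nax]]] := pselect (b `<=` a).
  by exists s; rewrite -aE; apply/seteqP.
apply: (IH _ (ideal_gen_is_ideal [set f | f \in x :: s]) _ (x :: s)) => //.
  split; last by move=> /(_ x) H; apply/nax/H/sub_ideal_gen; exact: mem_head.
  by rewrite aE; apply: ideal_gen_mono => f fs; apply: sub_ideal_gen; rewrite /= inE fs orbT.
by move=> f; rewrite /= inE => /predU1P[->//|]; exact: sb.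
Qed.

End Noetherian.

Section HilbertFunction.
Variables (n : nat) (k : fieldType).
Local Notation T := (mpoly.mpoly n k).
Local Notation homog d f := (f \is ishomog1 d (@mdeg n)).
Local Notation m0 := (@irrelevant_ideal n k).
Implicit Types (a : set T) (f g h : T).

Definition homogeneous_prime_chain a (D : nat) (c : nat -> set T) : Prop :=
  [/\ prime_chain D c, forall i, (i <= D)%N -> graded (c i) & a `<=` c 0%N].

(** The length [D] of a chain of primes over [a] bounds the order of growth of the
    Hilbert function of [T / a]. *)
Definition polynomial_growth a : Prop :=
  exists D C c, homogeneous_prime_chain a D c /\
    forall d, dim_le (@low n k d) a (C * d.+1 ^ D).

Lemma irrelevant_prime : prime_ideal m0.
Proof.
split; first exact: graded_ideal (irrelevant_graded n k).
  exact: nirrelevant1.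
move=> f g fg; apply: contrapT => /not_orP[mf mg].
exact: (nirrelevantM mf mg) fg.
Qed.

(** As [g] is regular modulo [a], the Hilbert functions satisfy
    [H_a(d) <= H_(a + (g))(d) + H_a(d - 1)]. Summation costs one power of [d], and
    [a] itself can be put in front of a chain of primes over [a + (g)]. *)
Lemma growth_adjoin a e g : graded a -> prime_ideal a -> homog e g ->
  (0 < e)%N -> ~ a g -> polynomial_growth (adjoin a g) -> polynomial_growth a.
Proof.
move=> ga pa hg e0 nag [D [C [c [[[cp cs] cg ac] cdim]]]].
have Ia := graded_ideal ga.
exists D.+1, C, (fun i => if i is j.+1 then c j else a); split.
  split=> // [|[|i]//]; last exact: cg.
  split=> -[|i] //; [exact: cp | move=> _ | exact: cs].
  split; first exact: subset_trans (adjoin_sub _) ac.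
  by move=> H; apply: nag; apply: H; apply: ac; exact: adjoin_mem.
have aL := fun c f g => @ideal_lin n k a c f g Ia.
suff H d : dim_le (@low n k d) a (d * (C * d.+1 ^ D)).
  move=> d; apply: dim_le_mono (H d).
  by rewrite expnS mulnCA leq_mul2l leq_mul2r leqnSn !orbT.
have [d' le_d'] := ubnP d; elim: d' d le_d' => // d' IH [|d] dd'.
  exists 0%N, (fun=> 0); split=> [//|[]//|f].
  rewrite /low/= leqn0 mmeasure_poly_eq0 => /eqP ->; exists (fun=> 0).
  by rewrite big_ord0 subr0; exact: ideal0.
rewrite mulSn; apply: (dim_le_exact ga hg) => //.
have -> : colon_elt a g = a.
  apply/seteqP; split; last exact: colon_elt_sub.
  by case: pa => _ _ pa f /pa[].
apply: (@dim_le_sub _ _ _ (@low n k d)) => //.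
  move=> f; rewrite /low/=; move/leq_trans; apply.
  by rewrite leq_subLR (leq_add2r d 1 e).
apply: dim_le_mono (IH d dd'); rewrite !leq_mul2l.
by rewrite leq_exp_base ?orbT.
Qed.

Lemma growth_split a e g : graded a -> homog e g ->
  polynomial_growth (adjoin a g) -> polynomial_growth (colon_elt a g) ->
  polynomial_growth a.
Proof.
move=> ga hg [D [C [c [[pc cg ac] cdim]]]] [D' [C' [c' [[pc' cg' ac'] cdim']]]].
have Ia := graded_ideal ga.
have bound d : dim_le (@low n k d) a ((C + C') * d.+1 ^ maxn D D').
  apply: dim_le_mono (dim_le_exact ga hg (cdim d) (cdim' (d - e)%N)).
  rewrite mulnDl; apply: leq_add; apply: leq_mul => //.
    by rewrite leq_pexp2l // leq_maxl.
  apply: (@leq_trans (d.+1 ^ D')).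
    by rewrite leq_exp_base // ltnS leq_subr.
  by rewrite leq_pexp2l // leq_maxr.
case: (leqP D D') bound => DD' bound.
  exists D', (C + C')%N, c'; split=> //; split=> //.
  exact: (subset_trans (colon_elt_sub _ Ia)) ac'.
exists D, (C + C')%N, c; split=> //; split=> //.
exact: subset_trans (adjoin_sub _) ac.
Qed.

(** Noetherian induction on [a]. The irrelevant ideal is clear. If [a] is another
    prime, it misses a variable, which is adjoined to it. If [a] is not prime, it
    contains a product [f g] of homogeneous elements outside [a], and the strictly
    larger ideals [a + (f)] and [a : f] control [a]. *)
Theorem proper_graded_growth a : graded a -> ~ a 1 -> polynomial_growth a.
Proof.
move=> ga; move: (ga); move: a {ga} (graded_ideal ga).
apply: ideal_noetherian_ind => a Ia IH ga a1.
have am f : a f -> m0 f := @graded_proper n k a f ga a1.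
have [ma|] := pselect (m0 `<=` a).
  have -> : a = m0 by apply/seteqP; split.
  exists 0%N, 1%N, (fun=> m0); split; last first.
    by move=> d; rewrite expn0 muln1; exact: dim_le_irrelevant.
  split=> // [|i _]; last exact: irrelevant_graded.
  by split=> // i _; exact: irrelevant_prime.
move=> nma; have [pa|npa] := pselect (prime_ideal a).
  have [i nai] : exists i, ~ a (mpolyX k (mnm1 i)).
    apply: contrapT => H; apply: nma; apply: ideal_gen_sub => // _ [i _ <-].
    by apply: contrapT => nai; apply: H; exists i.
  have hX : homog 1 (mpolyX k (mnm1 i)) by rewrite dhomogX /= mdeg1.
  apply: (growth_adjoin ga pa hX) => //.
  have gX := adjoin_graded ga hX.
  apply: IH => //; first exact: graded_ideal.
    split; first exact: adjoin_sub.
    by move=> H; apply: nai; apply: H; exact: adjoin_mem.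
  by apply: adjoin_proper => //; apply: sub_ideal_gen; exists i.
have [e [f [g [hf [afg [naf nag]]]]]] : exists e f g,
    homog e f /\ a (f * g) /\ ~ a f /\ ~ a g.
  apply: contrapT => H; apply: npa; apply: graded_prime => //.
  move=> i j f g hf hg afg; apply: contrapT => /not_orP[naf nag].
  by apply: H; exists i, f, g.
have mf : m0 f.
  apply: contrapT => nmf; apply: nag; apply: (graded_contract ga nmf).
  by rewrite mulrC.
have gA := adjoin_graded ga hf; have gC := colon_elt_graded ga hf.
apply: (growth_split ga hf); apply: IH => //; try exact: graded_ideal.
- split; first exact: adjoin_sub.
  by move=> H; apply: naf; apply: H; exact: adjoin_mem.
- exact: adjoin_proper.
- split; first exact: colon_elt_sub.
  by move=> H; apply: nag; apply: H; rewrite /colon_elt/= mulrC.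
- by rewrite /colon_elt/= mul1r.
Qed.

End HilbertFunction.

(** * Trace over the Frobenius powers *)

Section MonomialExtension.
Variables (n : nat) (k : fieldType) (V : lmodType k).
Local Notation T := (mpoly.mpoly n k).
Local Notation mono u := (mpolyX k u).

Lemma mpoly_ext_additive (W : zmodType) (G H : T -> W) :
  {morph G : f g / f + g} -> {morph H : f g / f + g} ->
  (forall c u, G (c *: mono u) = H (c *: mono u)) -> G =1 H.
Proof.
move=> GD HD GH f.
have G0 : G 0 = 0 by apply: (addrI (G 0)); rewrite -GD !addr0.
have H0 : H 0 = 0 by apply: (addrI (H 0)); rewrite -HD !addr0.
rewrite (mpolyE f); elim: (msupp f : seq _) => [|u s IH].
  by rewrite big_nil G0 H0.
by rewrite big_cons GD HD IH GH.
Qed.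

(** Additive extension from the terms [c X^u]. The trace of a polynomial ring
    over its [q]-th powers ([tau] the identity), the Frobenius twist of the
    coefficients ([tau] the [q]-th power) and a splitting of Frobenius ([tau] a
    [p^-1]-linear functional) are all of this form. *)
Definition monext (tau : k -> k) (F : multinom n -> V) (f : T) : V :=
  \sum_(u <- msupp f) tau (mcoeff u f) *: F u.

Variables (tau : k -> k) (F : multinom n -> V).
Hypothesis tauD : {morph tau : x y / x + y}.

Let tau0 : tau 0 = 0.
Proof. by apply: (addrI (tau 0)); rewrite -tauD !addr0. Qed.

Lemma monext_sup (s : seq (multinom n)) f : uniq s -> {subset msupp f <= s} ->
  monext tau F f = \sum_(u <- s) tau (mcoeff u f) *: F u.
Proof.
move=> us fs; rewrite [RHS](bigID [in msupp f]) /= [X in _ + X]big1 ?addr0.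
  rewrite -[RHS]big_filter; apply: perm_big; apply: uniq_perm.
  - exact: msupp_uniq.
  - exact: filter_uniq.
  - by move=> u; rewrite mem_filter andb_idr //; exact: fs.
by move=> u /memN_msupp_eq0 ->; rewrite tau0 scale0r.
Qed.

Lemma monextD : {morph monext tau F : f g / f + g}.
Proof.
move=> f g; pose s := undup (msupp f ++ msupp g ++ msupp (f + g)).
have us : uniq s := undup_uniq _.
rewrite !(@monext_sup s) //; try by move=> u us'; rewrite mem_undup !mem_cat us' ?orbT.
by rewrite -big_split; apply: eq_bigr => u _; rewrite mcoeffD tauD scalerDl.
Qed.

Lemma monextX c u : monext tau F (c *: mono u) = tau c *: F u.
Proof.
rewrite (@monext_sup [:: u]) //; last first.
  by move=> v /msuppZ_le; rewrite msuppX.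
by rewrite big_seq1 mcoeffZ mcoeffX eqxx mulr1.
Qed.

Lemma monext0 : monext tau F 0 = 0.
Proof. by rewrite /monext msupp0 big_nil. Qed.

Lemma monext_sum (I : Type) (s : seq I) (P : pred I) f :
  monext tau F (\sum_(i <- s | P i) f i) = \sum_(i <- s | P i) monext tau F (f i).
Proof. exact: (big_morph _ monextD monext0). Qed.

End MonomialExtension.

Section PolynomialTrace.
Variables (n : nat) (k : fieldType) (p e : nat).
Hypothesis char_k : p \in [pchar k].
Local Notation T := (mpoly.mpoly n k).
Local Notation mono u := (mpolyX k u).
Local Notation q := (p ^ e)%N.
Local Notation homog d f := (f \is ishomog1 d (@mdeg n)).
Implicit Types (J : set T) (f g r : T) (u v : multinom n).

Let p_prime : prime p := pcharf_prime char_k.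

Let q_gt0 : (0 < q)%N. Proof. by rewrite expn_gt0 prime_gt0. Qed.

Lemma char_mpoly : p \in [pchar T].
Proof. by rewrite (pchar_lalg T). Qed.

Lemma frobD (A : comNzRingType) (charA : p \in [pchar A]) :
  {morph (fun x : A => x ^+ q) : x y / x + y}.
Proof.
by move=> x y; rewrite exprDn_pchar // (eq_pnat _ (pcharf_eq charA)) pnatX pnat_id.
Qed.

(** [tr_exact u] holds when [X^u] is [X^(q v + q - 1)] for some [v], which is
    then [tr_mon u]. *)
Definition tr_exact u : bool := [forall i, (u i %% q == q.-1)%N].

Definition tr_mon u : multinom n := Multinom [tuple (u i %/ q)%N | i < n].

(** The generator of [Hom(T, k[X^q])] composed with [X^q |-> X]; being
    [k]-linear it needs no choice of a functional on [k]. *)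
Definition ptrace : T -> T :=
  monext idfun (fun u => if tr_exact u then mono (tr_mon u) else 0).

Definition ftwist : T -> T := monext (fun c => c ^+ q) (fun u => mono u).

Definition xpow : T -> T := comp_mpoly [tuple mono (mnm1 i) ^+ q | i < n].

Lemma ptraceD : {morph ptrace : f g / f + g}. Proof. exact: monextD. Qed.

Lemma ptraceX c u : ptrace (c *: mono u) = if tr_exact u then c *: mono (tr_mon u) else 0.
Proof. by rewrite /ptrace monextX //; case: ifP; rewrite ?scaler0. Qed.

Lemma ptrace_sum (I : Type) (s : seq I) (P : pred I) (F : I -> T) :
  ptrace (\sum_(i <- s | P i) F i) = \sum_(i <- s | P i) ptrace (F i).
Proof. exact: monext_sum. Qed.

Lemma ptraceZ c f : ptrace (c *: f) = c *: ptrace f.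
Proof.
apply: (@mpoly_ext_additive _ _ _ (fun f => ptrace (c *: f)) (fun f => c *: ptrace f)).
- by move=> x y; rewrite scalerDr ptraceD.
- by move=> x y; rewrite ptraceD scalerDr.
- by move=> c' u; rewrite scalerA !ptraceX; case: ifP; rewrite ?scaler0 ?scalerA.
Qed.

Lemma ftwistD : {morph ftwist : f g / f + g}.
Proof. by apply: monextD; exact: frobD. Qed.

Lemma ftwist0 : ftwist 0 = 0. Proof. exact: monext0. Qed.

Lemma ftwistN : {morph ftwist : f / - f}.
Proof. by move=> f; apply: (addrI (ftwist f)); rewrite -ftwistD !subrr ftwist0. Qed.

Lemma ftwistX c u : ftwist (c *: mono u) = c ^+ q *: mono u.
Proof. by rewrite /ftwist monextX //; exact: frobD. Qed.

Lemma ftwistZ c f : ftwist (c *: f) = c ^+ q *: ftwist f.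
Proof.
apply: (@mpoly_ext_additive _ _ _ (fun f => ftwist (c *: f)) (fun f => c ^+ q *: ftwist f)).
- by move=> x y; rewrite scalerDr ftwistD.
- by move=> x y; rewrite ftwistD scalerDr.
- by move=> c' u; rewrite scalerA !ftwistX scalerA exprMn.
Qed.

Lemma xpowX u : xpow (mono u) = mono (mnm_muln u q).
Proof.
rewrite /xpow comp_mpolyX [RHS](mpolyXE_id) ; apply: eq_bigr => i _.
by rewrite tnth_mktuple mulmnE -exprM mulnC.
Qed.

Lemma xpow_ftwist f : xpow (ftwist f) = f ^+ q.
Proof.
apply: (@mpoly_ext_additive _ _ _ (fun f => xpow (ftwist f)) (fun f => f ^+ q)).
- by move=> x y; rewrite ftwistD /xpow raddfD.
- exact: (frobD char_mpoly).
- by move=> c u; rewrite ftwistX /xpow linearZ /= -/xpow xpowX exprZn mpolyXn.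
Qed.

Lemma tr_add u v : tr_exact (mnm_add u (mnm_muln v q)) = tr_exact u.
Proof. by apply: eq_forallb => i /=; rewrite mnmDE mulmnE addnC modnMDl. Qed.

Lemma tr_mon_add u v : tr_mon (mnm_add u (mnm_muln v q)) = mnm_add (tr_mon u) v.
Proof.
by apply/mnmP => i; rewrite !mnmE mulmnE addnC divnMDl // addnC.
Qed.

Lemma ptrace_mul f r : ptrace (r * f ^+ q) = ftwist f * ptrace r.
Proof.
rewrite -xpow_ftwist.
pose G g := ptrace (r * xpow g); pose H g := g * ptrace r.
suff : G =1 H by move/(_ (ftwist f)).
apply: mpoly_ext_additive.
- by move=> x y; rewrite /G /xpow raddfD mulrDr ptraceD.
- by move=> x y; rewrite /H mulrDl.
move=> c u; rewrite /G /H /xpow linearZ /= -/xpow xpowX.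
rewrite -scalerAr ptraceZ -scalerAl; congr (_ *: _).
apply: (@mpoly_ext_additive _ _ _ (fun r => ptrace (r * mono (mnm_muln u q)))
          (fun r => mono u * ptrace r)).
- by move=> x y; rewrite mulrDl ptraceD.
- by move=> x y; rewrite ptraceD mulrDr.
move=> c' v; rewrite -scalerAl -mpolyXD !ptraceX tr_add tr_mon_add.
by case: ifP; rewrite ?mulr0 // -scalerAr mpolyXD mulrC.
Qed.

Definition box_mon (a : {ffun 'I_n -> 'I_q}) : multinom n :=
  Multinom [tuple (a i : nat) | i < n].

Definition box_compl (a : {ffun 'I_n -> 'I_q}) : multinom n :=
  Multinom [tuple (q.-1 - a i)%N | i < n].

Lemma mod_compl (v a : nat) : (a < q)%N ->
  ((v + (q.-1 - a)) %% q == q.-1)%N = (a == v %% q)%N.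
Proof.
move=> aq; rewrite {1}(divn_eq v q) -addnA modnMDl.
have := ltn_pmod v q_gt0; move: (v %% q)%N => r rq.
apply/eqP/eqP => [|->]; last by rewrite subnKC ?modn_small ?prednK // -ltnS prednK.
have [ra|ar] := leqP r a.
  by rewrite modn_small; lia.
rewrite (_ : (r + (q.-1 - a) = 1 * q + (r - a).-1)%N); last by lia.
by rewrite modnMDl modn_small; lia.
Qed.

(** The [q]-adic expansion of [f] over the basis [X^a], [0 <= a_i < q], of [T] over
    [k[X^q]]: multiplying by [X^(q-1-a)] moves the coefficient of [X^a] into the
    position that the trace reads. *)
Lemma ptrace_expand f :
  f = \sum_a xpow (ptrace (f * mono (box_compl a))) * mono (box_mon a).
Proof.
apply: (@mpoly_ext_additive _ _ _ id
  (fun f => \sum_a xpow (ptrace (f * mono (box_compl a))) * mono (box_mon a))) => //.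
- move=> x y; rewrite -big_split /=; apply: eq_bigr => a _.
  by rewrite mulrDl ptraceD /xpow raddfD mulrDl.
move=> c v; pose a0 : {ffun 'I_n -> 'I_q} :=
  [ffun i => Ordinal (ltn_pmod (v i) q_gt0)].
have exactE a : tr_exact (mnm_add v (box_compl a)) = (a == a0).
  apply/forallP/eqP => [H|->].
    apply/ffunP => i; apply/val_inj; rewrite ffunE /=; apply/eqP.
    by rewrite -(mod_compl _ (ltn_ord (a i))); have := H i; rewrite mnmDE mnmE.
  by move=> i; rewrite mnmDE mnmE mod_compl // ffunE /=.
rewrite (bigD1 a0) //= big1 => [|a /negPf aa0]; last first.
  by rewrite -scalerAl -mpolyXD ptraceX exactE aa0 /xpow raddf0 mul0r.
rewrite addr0 -scalerAl -mpolyXD ptraceX exactE eqxx /xpow linearZ /= -/xpow xpowX.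
rewrite -scalerAl -mpolyXD; congr (_ *: mono _); apply/mnmP => i.
rewrite mnmDE mulmnE !mnmE ffunE /= [LHS](divn_eq (v i) q).
congr (_ * _ + _)%N; rewrite {2}(divn_eq (v i) q) -addnA divnMDl //.
rewrite subnKC; last by rewrite -ltnS prednK // ltn_pmod.
by rewrite (divn_small (m := q.-1)) ?addn0 // prednK.
Qed.

(** The base change of [J] along the Frobenius of [k]; [J^[q]] is generated by its
    image under [X |-> X^q]. *)
Definition twisted_ideal J : set T := ideal_gen [set ftwist f | f in J].

Lemma ptrace_frob_power J f : frob_power p e J f -> twisted_ideal J (ptrace f).
Proof.
move=> [m [r [s [Js ->]]]]; rewrite ptrace_sum.
have Ig : is_ideal (twisted_ideal J) := ideal_gen_is_ideal _.
apply: ideal_sum => // i _; have [g Jg <-] := Js i.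
by rewrite ptrace_mul; apply: idealMr => //; apply: sub_ideal_gen; exists g.
Qed.

Lemma frob_power_ptrace J f :
  (forall a, twisted_ideal J (ptrace (f * mono (box_compl a)))) -> frob_power p e J f.
Proof.
move=> H; rewrite (ptrace_expand f).
have If : is_ideal (frob_power p e J) := ideal_gen_is_ideal _.
apply: ideal_sum => // a _; apply: idealMr => //.
have [m [r [s [Js ->]]]] := H a; rewrite /xpow raddf_sum /=.
apply: ideal_sum => // i _; rewrite rmorphM /= -/xpow; apply: idealM => //.
by have [g Jg <-] := Js i; rewrite xpow_ftwist; apply: sub_ideal_gen; exists g.
Qed.

(** Base change along Frobenius does not change the Hilbert function. *)
Lemma dim_le_twist J d K : dim_le (@low n k d) J K ->
  dim_le (@low n k d) (twisted_ideal J) K.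
Proof.
move=> [m [g [mK lg gs]]]; have IJ : is_ideal (twisted_ideal J) := ideal_gen_is_ideal _.
have low_mono u : (mdeg u < d)%N -> low d (mono u) by rewrite /low/= msizeX.
have low_twist f : low d f -> low d (ftwist f).
  move=> lf; rewrite /ftwist /monext big_seq; apply: low_sum => u us.
  rewrite -[_ *: _]add0r; apply: low_lin; first exact: low0.
  by apply: low_mono; apply: leq_trans lf; exact: msize_mdeg_lt.
exists m, (fun i => ftwist (g i)); split=> //; first by move=> i; exact: low_twist.
move=> f lf.
pose Sp f := exists c : 'I_m -> k,
  twisted_ideal J (f - \sum_i c i *: ftwist (g i)).
rewrite (mpolyE f) big_seq; apply: (big_ind Sp).
- by exists (fun=> 0); rewrite big1 ?subr0 => [|i _]; [exact: ideal0 | rewrite scale0r].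
- move=> x y [c Hc] [c' Hc']; exists (fun i => c i + c' i).
  under eq_bigr do rewrite scalerDl.
  by rewrite big_split /= opprD addrACA; exact: idealD.
move=> u uf; have /gs[c Hc] : low d (mono u).
  by apply: low_mono; apply: leq_trans lf; exact: msize_mdeg_lt.
exists (fun i => mcoeff u f * c i ^+ q).
under eq_bigr do rewrite -scalerA -ftwistZ.
rewrite -scaler_sumr -scalerBr; apply: ideal_scale => //.
apply: sub_ideal_gen; exists (mono u - \sum_i c i *: g i) => //.
rewrite ftwistD -(scale1r (mono u)) ftwistX expr1n; congr (_ + _).
rewrite ftwistN; congr (- _).
exact: (big_morph ftwist ftwistD ftwist0).
Qed.

Lemma low_ptrace d f : low d.+1 f -> low (d %/ q).+1 (ptrace f).
Proof.
rewrite /low/= => lf; rewrite /ptrace /monext big_seq.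
apply: low_sum => u uf; case: ifP => _; last by rewrite scaler0; exact: low0.
rewrite -[_ *: _]add0r; apply: low_lin; first exact: low0.
rewrite /low/= msizeX ltnS leq_divRL //.
apply: (@leq_trans (mdeg u)); last first.
  by rewrite -ltnS; apply: leq_trans lf; exact: msize_mdeg_lt.
rewrite !mdegE big_distrl /=; apply: leq_sum => i _.
by rewrite mnmE leq_trunc_div.
Qed.

(** Multiplication by [f] carries [T / J] to [T / J^[q]], and [f] modulo
    [J^[q]] is recovered from the traces of [f g], with [g] running over
    polynomials of degree at most [n q] modulo [J]. Such a trace has
    degree at most [deg f / q + n], whence the product of two values of the
    Hilbert function. *)
Lemma dim_le_colon J (U : set T) d K K' : is_ideal J ->
  U `<=` low d.+1 -> U `<=` colon (frob_power p e J) J ->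
  dim_le (@low n k (n * q).+1) J K ->
  dim_le (@low n k ((d + n * q) %/ q).+1) J K' ->
  dim_le U (frob_power p e J) (K * K').
Proof.
move=> IJ Ulow Ucolon [m [g [mK lg gs]]] /dim_le_twist[m' [h [mK' lh hs]]].
have Iq : is_ideal (frob_power p e J) := ideal_gen_is_ideal _.
have It : is_ideal (twisted_ideal J) := ideal_gen_is_ideal _.
apply: (@dim_le_mono _ _ _ _ (m * m')); first exact: leq_mul.
pose Rho (f : T) (w : 'rV[k]_(m * m')) := colon (frob_power p e J) J f /\
  forall i, twisted_ideal J (ptrace (f * g i) - \sum_j vec_mx w i j *: h j).
apply: (@dim_le_coord _ _ _ _ _ Rho).
- move=> c f f' w w' [cf Hf] [cf' Hf']; split.
    move=> y Jy; rewrite mulrDl -scalerAl.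
    by apply: (idealD Iq); [exact: cf | apply: ideal_scale => //; exact: cf'].
  move=> i; rewrite mulrDl -scalerAl ptraceD ptraceZ.
  under eq_bigr do rewrite linearD linearZ /= [X in X *: _]mxE [X in (_ + X) *: _]mxE scalerDl -scalerA.
  rewrite big_split /= -scaler_sumr opprD addrACA -scalerBr.
  by apply: (idealD It); [exact: Hf | apply: (ideal_scale _ It); exact: Hf'].
- move=> f Uf.
  have /choice[c Hc] i : exists c : 'I_m' -> k,
      twisted_ideal J (ptrace (f * g i) - \sum_j c j *: h j).
    apply: hs; apply: low_ptrace.
    have [->|f0] := eqVneq f 0; first by rewrite mul0r; exact: low0.
    have [->|g0] := eqVneq (g i) 0; first by rewrite mulr0; exact: low0.
    move: (Ulow _ Uf) (lg i); rewrite /low/= msizeM //.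
    move: (mmeasure _ f) (mmeasure _ (g i)) => a b; move: (n * q)%N => N; lia.
  exists (mxvec (\matrix_(i, j) c i j)); split; first exact: Ucolon.
  move=> i; rewrite mxvecK; under eq_bigr do rewrite mxE.
  exact: Hc.
- move=> f [cf H]; apply: frob_power_ptrace => a.
  have /gs[c Hc] : low (n * q).+1 (mono (box_compl a)).
    rewrite /low/= msizeX ltnS mdegE.
    rewrite -[n in (n * _)%N]card_ord -sum_nat_const; apply: leq_sum => i _.
    by rewrite mnmE; lia.
  rewrite -(subrK (\sum_i c i *: g i) (mono (box_compl a))) mulrDr ptraceD.
  apply: idealD => //; first by apply: ptrace_frob_power; exact: cf.
  rewrite mulr_sumr ptrace_sum; apply: ideal_sum => // i _.
  rewrite -scalerAr ptraceZ; apply: ideal_scale => //.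
  have := H i; rewrite big1 ?subr0 // => j _.
  by rewrite linear0 mxE scale0r.
Qed.

(** In characteristic [p] the [q]-th powers of the homogeneous elements of [J]
    suffice. *)
Lemma frob_power_graded J : graded J -> graded (frob_power p e J).
Proof.
move=> gJ; have IJ := graded_ideal gJ.
suff -> : frob_power p e J =
    ideal_gen [set g | exists d f, [/\ J f, homog d f & g = f ^+ q]].
  apply: ideal_gen_graded => _ [d [f [_ hf ->]]].
  by exists (d * q)%N; exact: dhomogMn.
apply/seteqP; split; apply: ideal_gen_mono; last first.
  by move=> _ [d [f [Jf _ ->]]]; apply: sub_ideal_gen; exists f.
move=> _ [f Jf <-]; rewrite (hc_sum (leqnn (mmeasure (@mdeg n) f))).
set I := ideal_gen _; have Ii : is_ideal I := ideal_gen_is_ideal _.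
have z : (0 : T) ^+ q = 0 by rewrite expr0n gtn_eqF.
rewrite (big_morph (fun x : T => x ^+ q) (frobD char_mpoly) z).
apply: ideal_sum => // d _; apply: sub_ideal_gen.
by exists (d : nat), (pihomog (@mdeg n) d f); split=> //; [exact: gradedP | exact: pihomogP].
Qed.

End PolynomialTrace.

(** * The local ring at the origin and its quotient *)

Section QuotientMap.
Variables (A : comNzRingType) (X : set A).

Lemma quot_pi0 : quot_pi X 0 = 0.
Proof. by apply: (addrI (quot_pi X 0)); rewrite -quot_pi_add !addr0. Qed.

Lemma quot_pi_sum (I : Type) (s : seq I) (P : pred I) (F : I -> A) :
  quot_pi X (\sum_(i <- s | P i) F i) = \sum_(i <- s | P i) quot_pi X (F i).
Proof. exact: (big_morph _ (@quot_pi_add _ X) quot_pi0). Qed.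

Lemma quot_pi_eq0 x : ideal_gen X x -> quot_pi X x = 0.
Proof. by move=> Ix; rewrite -quot_pi0; apply/quot_piP; rewrite subr0. Qed.

End QuotientMap.

Section LocalRing.
Variables (n : nat) (k : fieldType).
Local Notation T := (mpoly.mpoly n k).
Local Notation S := (local_ring n k).
Local Notation m0 := (@irrelevant_ideal n k).
Local Notation loc := (@loc_of n k).
Implicit Types (b : set T) (f g : T) (x y : S).

Lemma locB : {morph loc : f g / f - g}.
Proof. by move=> f g; apply: val_inj; rewrite /= tofracB. Qed.

Lemma loc0 : loc 0 = 0. Proof. by rewrite -(subrr 0) locB subrr. Qed.

Lemma locD : {morph loc : f g / f + g}.
Proof. by move=> f g; rewrite -[g in LHS]opprK -(sub0r g) !locB loc0 sub0r opprK. Qed.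

Lemma locM : {morph loc : f g / f * g}.
Proof. by move=> f g; apply: val_inj; rewrite /= tofracM. Qed.

Lemma loc1 : loc 1 = 1. Proof. by apply: val_inj; rewrite /= tofrac1. Qed.

Lemma locX f i : loc (f ^+ i) = loc f ^+ i.
Proof. by elim: i => [|i IH]; rewrite ?expr0 ?loc1 // !exprS locM IH. Qed.

Lemma loc_inj : injective loc.
Proof. by move=> f g /(congr1 val) /= /eqP; rewrite tofrac_eq => /eqP. Qed.

Lemma loc_unit g : ~ m0 g -> exists y, y * loc g = 1.
Proof.
move=> gm; have yP : in_loc ((FracField.tofrac g)^-1).
  by apply/asboolP; exists 1, g; rewrite tofrac1 div1r.
exists (LocalRing yP); apply: val_inj; rewrite /= mulVf //.
by rewrite tofrac_eq0; exact: nirrelevant_neq0.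
Qed.

Lemma loc_frac x : exists f g, ~ m0 g /\ x * loc g = loc f.
Proof.
case: x => x xP; have [f [g [gm E]]] := asboolP _ xP.
exists f, g; split=> //; apply: val_inj; rewrite /= E divfK //.
by rewrite tofrac_eq0; exact: nirrelevant_neq0.
Qed.

Lemma extension_frac b x : is_ideal b ->
  extension b x <-> exists f g, [/\ b f, ~ m0 g & x * loc g = loc f].
Proof.
move=> Ib; have Ie : is_ideal (extension b) := ideal_gen_is_ideal _.
split=> [|[f [g [bf gm E]]]]; last first.
  have [y yg] := loc_unit gm.
  rewrite -(mulr1 x) -yg mulrCA E; apply: idealM => //.
  by apply: sub_ideal_gen; exists f.
suff H : extension b `<=`
      [set x | exists f g, [/\ b f, ~ m0 g & x * loc g = loc f]] by exact: H.
apply: ideal_gen_sub => [|_ [f bf <-]]; last first.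
  by exists f, 1; rewrite loc1 mulr1; split=> //; exact: nirrelevant1.
split.
- by exists 0, 1; rewrite mul0r loc0; split=> //; [exact: ideal0 | exact: nirrelevant1].
- move=> y z [f [g [bf gm E]]] [f' [g' [bf' gm' E']]].
  exists (f * g' + f' * g), (g * g'); split; last 2 first.
  + exact: nirrelevantM.
  + by rewrite locD !locM -E -E' mulrDl mulrA; congr (_ + _); rewrite -mulrA [loc g * _]mulrC.
  by apply: idealD => //; exact: idealMr.
- move=> r y [f [g [bf gm E]]]; have [f' [g' [gm' E']]] := loc_frac r.
  exists (f' * f), (g' * g); split; first exact: idealM.
    exact: nirrelevantM.
  by rewrite !locM -E -E' mulrACA.
Qed.

(** The equality of fractions has numerators in [T], where [graded_contract] applies. *)
Lemma extension_contract b f : graded b -> extension b (loc f) -> b f.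
Proof.
move=> gb /(extension_frac _ (graded_ideal gb))[f' [g [bf gm]]].
by rewrite -locM => /loc_inj E; apply: (graded_contract gb gm); rewrite E.
Qed.

Lemma frob_power_extension p e b : is_ideal b ->
  frob_power p e (extension b) `<=` extension (frob_power p e b).
Proof.
move=> Ib; have If : is_ideal (frob_power p e b) := ideal_gen_is_ideal _.
apply: ideal_gen_sub => [|_ [x /(extension_frac _ Ib)[f [g [bf gm E]]] <-]].
  exact: ideal_gen_is_ideal.
apply/extension_frac => //; exists (f ^+ (p ^ e)), (g ^+ (p ^ e)); split.
- by apply: sub_ideal_gen; exists f.
- elim: (p ^ e)%N => [|i IH]; first by rewrite expr0; exact: nirrelevant1.
  by rewrite exprS; exact: nirrelevantM.
- by rewrite !locX -exprMn E.
Qed.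

Lemma extension_frob_power p e b : is_ideal b ->
  loc @` frob_power p e b `<=` frob_power p e (extension b).
Proof.
move=> Ib _ [f [m [r [s [bs ->]]]] <-].
have If : is_ideal (frob_power p e (extension b)) := ideal_gen_is_ideal _.
rewrite (big_morph loc locD loc0); apply: ideal_sum => // i _.
rewrite locM; apply: idealM => //; have [g bg <-] := bs i; rewrite locX.
by apply: sub_ideal_gen; exists (loc g) => //; apply: sub_ideal_gen; exists g.
Qed.

Lemma extension_mono b b' : b `<=` b' -> extension b `<=` extension b'.
Proof.
by move=> bb'; apply: ideal_gen_mono => _ [f bf <-]; apply: sub_ideal_gen;
   exists f => //; exact: bb'.
Qed.

Section Quotient.
Variable J : set T.
Local Notation R := (quotient_local_ring J).
Local Notation pi := (@quot_pi S (loc @` J)).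

Definition quot_prime (P : set T) : set R := [set pi x | x in extension P].

Lemma quot_prime_pi P x : is_ideal P -> J `<=` P -> quot_prime P (pi x) ->
  extension P x.
Proof.
move=> IP JP [y Py /quot_piP yx].
have Ie : is_ideal (extension P) := ideal_gen_is_ideal _.
rewrite -(subKr y x); apply: idealB => //; exact: (extension_mono JP yx).
Qed.

Lemma quot_primeP P : graded P -> prime_ideal P -> J `<=` P ->
  prime_ideal (quot_prime P).
Proof.
move=> gP [IP P1 Pp] JP; have Ie : is_ideal (extension P) := ideal_gen_is_ideal _.
split; first split.
- by exists 0; [exact: ideal0 | exact: quot_pi0].
- move=> _ _ [x Px <-] [y Py <-]; exists (x + y); first exact: idealD.
  exact: quot_pi_add.
- move=> r _ [x Px <-]; have [s ->] := quot_pi_surj r.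
  by exists (s * x); [exact: idealM | exact: quot_pi_mul].
- move=> /(quot_prime_pi IP JP); rewrite -loc1 => /(extension_contract gP); exact: P1.
move=> u v; have [x ->] := quot_pi_surj u; have [y ->] := quot_pi_surj v.
have -> : pi x * pi y = pi (x * y) by rewrite quot_pi_mul.
move=> /(quot_prime_pi IP JP) Pxy.
have [f [g [gm E]]] := loc_frac x; have [f' [g' [gm' E']]] := loc_frac y.
have /(extension_contract gP)/Pp[Pf|Pf] : extension P (loc (f * f')).
- by rewrite locM -E -E' mulrACA; exact: idealMr.
- by left; exists x => //; apply/extension_frac => //; exists f, g.
- by right; exists y => //; apply/extension_frac => //; exists f', g'.
Qed.

(** Homogeneous primes over [J] lie in the maximal ideal, hence extend to distinct
    primes of the local ring. *)
Lemma krull_dim_ge (rT : realType) D c : homogeneous_prime_chain J D c ->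
  ((D%:R)%:E <= krull_dim R rT)%E.
Proof.
move=> [[cp cs] cg Jc]; apply: ereal_sup_ubound; exists D => //.
have Jci i : (i <= D)%N -> J `<=` c i.
  elim: i => // i IH iD; apply: subset_trans (IH (ltnW iD)) _.
  by case: (cs i iD).
exists (fun i => quot_prime (c i)); split=> i iD.
  by apply: quot_primeP; [exact: cg | exact: cp | exact: Jci].
have [sub nsub] := cs i iD; have iD' := ltnW iD; split.
  by move=> _ [x Px <-]; exists x => //; exact: extension_mono Px.
move=> H; apply: nsub => f cf.
apply: (extension_contract (cg i iD')); apply: quot_prime_pi.
- exact: graded_ideal (cg i iD').
- exact: Jci.
by apply: H; exists (loc f) => //; apply: sub_ideal_gen; exists f.
Qed.

End Quotient.

End LocalRing.

(** * Generators of Cartier subalgebras *)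

Section FedderSpan.
Variables (A : comNzRingType) (X : set A) (p e : nat).
Variables (tr : A -> A) (De : set (quotient_ring X -> quotient_ring X)) (b : set A).
Hypothesis tr_hom : hom_frob p e tr.
Hypothesis Hb : fedder_ideal p e tr De b.
Local Notation pi := (@quot_pi A X).
Local Notation I := (ideal_gen X).

Lemma hom_frob0 : tr 0 = 0.
Proof. by case: tr_hom => trD _; apply: (addrI (tr 0)); rewrite -trD !addr0. Qed.

Lemma hom_frob_sum (J : Type) (s : seq J) (P : pred J) (F : J -> A) :
  tr (\sum_(i <- s | P i) F i) = \sum_(i <- s | P i) tr (F i).
Proof. by case: tr_hom => trD _; exact: (big_morph tr trD hom_frob0). Qed.

(** [tr (r i^q) = i tr r]. *)
Lemma tr_frob_power x : frob_power p e I x -> I (tr x).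
Proof.
have Ii : is_ideal I := ideal_gen_is_ideal X.
move=> [m [r [s [Is ->]]]]; rewrite hom_frob_sum; apply: ideal_sum => // i _.
have [y Iy <-] := Is i; case: tr_hom => _ trM.
by rewrite mulrC trM; exact: idealMr.
Qed.

Lemma pi_tr_frob_power x y : frob_power p e I x -> pi (tr (x + y)) = pi (tr y).
Proof.
move=> Ix; case: tr_hom => trD _; rewrite trD quot_pi_add.
by rewrite quot_pi_eq0 ?add0r //; exact: tr_frob_power.
Qed.

(** Multiplication by [s] carries [I] into [I^[q]], and the trace carries [I^[q]]
    into [I]. *)
Lemma induced_map s : b s -> exists2 f, De f & forall u, f (pi u) = pi (tr (s * u)).
Proof.
move=> bs; case: Hb => Ib _ bcolon DE.
have [rep repK] := choice (@quot_pi_surj A X).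
have indE u : pi (tr (s * rep (pi u))) = pi (tr (s * u)).
  rewrite -[rep _](subrK u) mulrDr; apply: pi_tr_frob_power; apply: bcolon => //.
  by apply/quot_piP; rewrite -repK.
by exists (fun x => pi (tr (s * rep x))) => //; rewrite -DE; exists s.
Qed.

(** Elements of [I^[q]] induce the zero map, so generators of [J_e] modulo [I^[q]]
    induce generators of [D_e] over [R] acting by premultiplication. *)
Lemma fedder_span (K : nat) (g : 'I_K -> A) : (forall i, b (g i)) ->
  (forall s, b s -> exists c : 'I_K -> A,
     frob_power p e I (s - \sum_i c i * g i)) ->
  exists2 h : 'I_K -> quotient_ring X -> quotient_ring X,
    forall i, De (h i) &
    forall f, De f -> exists r : 'I_K -> quotient_ring X,
      f = (fun x => \sum_i h i (r i * x)).
Proof.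
move=> bg bspan.
have /choice[h Hh] : forall i, exists f, De f /\ forall u, f (pi u) = pi (tr (g i * u)).
  by move=> i; have [f Df fE] := induced_map (bg i); exists f.
exists h; first by move=> i; case: (Hh i).
have If : is_ideal (frob_power p e I) := ideal_gen_is_ideal _.
case: Hb => Ib _ bcolon <- f [s bs fE].
have [c Hc] := bspan s bs; exists (fun i => pi (c i)); apply/funext => x.
have [u ->] := quot_pi_surj x; rewrite fE -[s](subrK (\sum_i c i * g i)) mulrDl.
rewrite pi_tr_frob_power; last exact: idealMr.
rewrite mulr_suml hom_frob_sum quot_pi_sum; apply: eq_bigr => i _.
have -> : pi (c i) * pi u = pi (c i * u) by rewrite quot_pi_mul.
by case: (Hh i) => _ ->; rewrite mulrCA mulrA.
Qed.

End FedderSpan.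

Section GeneratorCount.
Variables (V : zmodType) (one : V) (mul : V -> V -> V) (rT : realType).
Local Notation graded_subring := (graded_subring one mul).
Local Notation subring_gen := (subring_gen one mul).
Local Notation trunc_subring := (trunc_subring one mul).
Local Notation gen_by := (gen_by one mul).
Local Notation gen_number := (gen_number one mul rT).
Implicit Types (A X Y : nat -> set V).

Lemma graded_subringD A i x y : graded_subring A -> A i x -> A i y -> A i (x + y).
Proof.
move=> [A0 AB _ _] Ax Ay; rewrite -[y]opprK; apply: (AB) => //.
by rewrite -[- y]add0r; apply: (AB).
Qed.

Lemma graded_subring_sum A i (J : Type) (s : seq J) (F : J -> V) :
  graded_subring A -> (forall j, A i (F j)) -> A i (\sum_(j <- s) F j).
Proof.
move=> gA AF; apply: big_ind => //; first by case: gA.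
by move=> x y; exact: graded_subringD.
Qed.

Lemma subring_gen_graded X : graded_subring (subring_gen X).
Proof.
split.
- by move=> i A [A0 _ _ _] _.
- by move=> i x y Hx Hy A gA XA; case: (gA) => _ AB _ _; apply: AB; [exact: Hx | exact: Hy].
- by move=> A [_ _ A1 _] _.
- move=> i j x y Hx Hy A gA XA; case: (gA) => _ _ _ AM.
  by apply: AM; [exact: Hx | exact: Hy].
Qed.

Lemma sub_subring_gen X i : X i `<=` subring_gen X i.
Proof. by move=> x Xx A _ XA; exact: XA. Qed.

Lemma subring_gen_min X A : graded_subring A -> (forall i, X i `<=` A i) ->
  forall i, subring_gen X i `<=` A i.
Proof. by move=> gA XA i x; apply. Qed.

Lemma subring_gen_mono X Y : (forall i, X i `<=` subring_gen Y i) ->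
  forall i, subring_gen X i `<=` subring_gen Y i.
Proof. exact: subring_gen_min (subring_gen_graded Y). Qed.

Lemma subring_gen_eq X Y : (forall i, X i `<=` subring_gen Y i) ->
  (forall i, Y i `<=` subring_gen X i) -> subring_gen X = subring_gen Y.
Proof.
by move=> XY YX; apply/funext => i; apply/seteqP; split; exact: subring_gen_mono.
Qed.

Section Components.
Variable A : nat -> set V.
Hypothesis gA : graded_subring A.

Lemma trunc_subring_mem e i : (i <= e)%N -> A i `<=` trunc_subring A e i.
Proof. by move=> ie x Ax; exact: sub_subring_gen. Qed.

Lemma trunc_subring_sub e i : trunc_subring A e i `<=` A i.
Proof. by apply: subring_gen_min => // j x []. Qed.

Lemma gen_by_mem e m d v (j : 'I_m) : gen_by A e d v -> A (d j) (v j).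
Proof.
move=> gb; apply: (@trunc_subring_sub e); rewrite gb.
by apply: sub_subring_gen; right; exists j.
Qed.

(** Generators of degree at least [e] do not contribute to the components of
    degree less than [e]; they may be replaced by [0]. *)
Lemma gen_by_pred e m d v : @gen_by A e m d v ->
  exists d' v', @gen_by A e.-1 m d' v'.
Proof.
case: e => [|e] gb; first by exists d, v.
pose d' j := if (d j <= e)%N then d j else 0%N.
pose v' j := if (d j <= e)%N then v j else 0.
exists d', v'; rewrite /Defs.gen_by; set Y := (X in _ = subring_gen X).
apply: subring_gen_eq => i x /=.
  move=> [ie Ax].
  have : trunc_subring A e.+1 i x by apply: trunc_subring_mem => //; exact: leqW.
  (* Nothing of degree above [e] is constrained by [B], so it is multiplicatively
     closed, and it contains all the old generators. *)
  rewrite gb; pose B l : set V := if (l <= e)%N then subring_gen Y l else setT.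
  suff gB : graded_subring B.
    move=> /(_ B gB); rewrite {2}/B ie; apply=> l y; rewrite /B.
    case: leqP => // le [[l0 A0y]|[j [djl <-]]].
      by apply: sub_subring_gen; left.
    by apply: sub_subring_gen; right; exists j; rewrite /d' /v' djl le.
  have [Y0 YB Y1 YM] := subring_gen_graded Y.
  split=> [l|l y z|//|l l' y z]; rewrite /B; try by case: leqP.
    by case: leqP => // _; exact: YB.
  case: (leqP (l + l') e) => // lle.
  by rewrite (leq_trans (leq_addr l' l) lle) (leq_trans (leq_addl l l') lle); exact: YM.
move=> [[-> Ax]|[j [<- <-]]]; first exact: trunc_subring_mem.
rewrite /d' /v'; case: leqP => dj; apply: trunc_subring_mem => //.
  exact: gen_by_mem gb.
by case: gA.
Qed.

(** The given generators of [G_e] produce all components of degree at most [e]; the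
    component of degree [e + 1] is produced by hypothesis. *)
Lemma gen_by_step e m d v K (w : 'I_K -> V) : @gen_by A e m d v ->
  (forall j, A e.+1 (w j)) ->
  A e.+1 `<=` subring_gen (fun i => [set x | ((i <= e)%N /\ A i x) \/
                                  (i = e.+1 /\ exists j, w j = x)]) e.+1 ->
  exists d' v', @gen_by A e.+1 (m + K) d' v'.
Proof.
move=> gb Aw Agen.
pose d' (j : 'I_(m + K)) := match fintype.split j with inl i => d i | inr _ => e.+1 end.
pose v' (j : 'I_(m + K)) := match fintype.split j with inl i => v i | inr i => w i end.
exists d', v'; rewrite /Defs.gen_by; set Y := (X in _ = subring_gen X).
have dl (i : 'I_m) : d' (lshift K i) = d i by rewrite /d' (unsplitK (inl i)).
have vl (i : 'I_m) : v' (lshift K i) = v i by rewrite /v' (unsplitK (inl i)).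
have dr (i : 'I_K) : d' (rshift m i) = e.+1 by rewrite /d' (unsplitK (inr i)).
have vr (i : 'I_K) : v' (rshift m i) = w i by rewrite /v' (unsplitK (inr i)).
have lowY i : (i <= e)%N -> A i `<=` subring_gen Y i.
  move=> ie x /(trunc_subring_mem ie); rewrite gb; move: i x ie => i x _.
  move: i x; apply: subring_gen_mono => i x [[-> A0x]|[j [<- <-]]].
    by apply: sub_subring_gen; left.
  by apply: sub_subring_gen; right; exists (lshift K j).
apply: subring_gen_eq => i x /=.
  move=> [+ Ax]; rewrite leq_eqVlt => /predU1P[ie|ie]; last exact: lowY.
  rewrite ie in Ax *; move: x Ax; apply: subset_trans Agen _.
  apply: subring_gen_mono => l y [[le Ay]|[-> [j <-]]]; first exact: lowY.
  by apply: sub_subring_gen; right; exists (rshift m j).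
move=> [[-> A0x]|[j [<- <-]]]; first exact: trunc_subring_mem.
case: (split_ordP j) => l ->; rewrite ?dl ?vl ?dr ?vr; last exact: trunc_subring_mem.
have : trunc_subring A e (d l) (v l).
  by rewrite gb; apply: sub_subring_gen; right; exists l.
move: (d l) (v l); apply: subring_gen_mono => i' x' [ie Ax].
by apply: trunc_subring_mem => //; exact: leqW.
Qed.

Local Open Scope ereal_scope.

Lemma gen_number_ge0 e : 0 <= gen_number A e.
Proof. by apply/ereal_infP => _ [m _ <-]; rewrite lee_fin ler0n. Qed.

Lemma gen_number_pred e : gen_number A e.-1 <= gen_number A e.
Proof.
apply/ereal_infP => _ [m [d [v gb]] <-]; apply: ereal_inf_lbound; exists m => //.
exact: gen_by_pred gb.
Qed.

Lemma gen_number0 : gen_number A 0 = 0.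
Proof.
apply/eqP; rewrite eq_le gen_number_ge0 andbT; apply: ereal_inf_lbound.
exists 0%N => //; exists (fun=> 0%N), (fun=> 0%R).
apply: subring_gen_eq => i x /=.
  by rewrite leqn0 => -[/eqP -> Ax]; apply: sub_subring_gen; left.
by move=> [[-> Ax]|[[]]] //; apply: sub_subring_gen.
Qed.

(** [K] further elements of degree [e] suffice to pass from [G_(e-1)] to [G_e]. *)
Definition extends_by e K : Prop := exists w : 'I_K -> V,
  (forall j, A e (w j)) /\
  A e `<=` subring_gen (fun i => [set x | ((i < e)%N /\ A i x) \/
                                 (i = e /\ exists j, w j = x)]) e.

Lemma extends_by_zero e : A e `<=` [set 0%R] -> extends_by e 0.
Proof.
move=> Ae0; exists (fun=> 0%R); split=> [[]//|x /Ae0 ->].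
by move=> B [B0 _ _ _] _; exact: B0.
Qed.

Lemma gen_number_step e K : extends_by e.+1 K ->
  gen_number A e.+1 <= gen_number A e + (K%:R)%:E.
Proof.
move=> [w [Aw Agen]]; rewrite -leeBlDr //.
apply/ereal_infP => _ [m [d [v gb]] <-]; rewrite leeBlDr //.
rewrite -EFinD -natrD; apply: ereal_inf_lbound; exists (m + K)%N => //.
exact: gen_by_step gb Aw Agen.
Qed.

Lemma gen_number_fin : (forall e, exists K, extends_by e.+1 K) ->
  forall e, gen_number A e \is a fin_num.
Proof.
move=> H; elim=> [|e IH]; first by rewrite gen_number0.
have [K HK] := H e; rewrite ge0_fin_numE ?gen_number_ge0 //.
by apply: le_lt_trans (gen_number_step HK) _; rewrite lte_add_pinfty ?ltry // -ge0_fin_numE ?gen_number_ge0.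
Qed.

Lemma gen_number_diff e K : (forall e, exists K, extends_by e.+1 K) ->
  extends_by e.+1 K ->
  `|gen_number A e.+1 - gen_number A e| <= (K%:R)%:E.
Proof.
move=> H HK; have Hfin := gen_number_fin H.
rewrite gee0_abs; last by rewrite sube_ge0 ?Hfin //; exact: (gen_number_pred e.+1).
by rewrite leeBlDl //; exact: gen_number_step.
Qed.

End Components.

Lemma complexity_le A (N C : rT) : (0 < N)%R ->
  (\forall e \near \oo, `|gen_number A e - gen_number A e.-1| <= (C * N ^+ e)%:E)%E ->
  (complexity one mul rT A <= N%:E)%E.
Proof. by move=> N0 H; apply: ereal_inf_lbound; exists N => //; split=> //; exists C. Qed.

End GeneratorCount.

(** Sums and premultiplications stay in the ring generated, so the spanning
    families of [fedder_span] generate. *)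
Lemma cartier_extends_by (p e : nat) (B : comPzRingType) (D : nat -> set (B -> B))
  (K : nat) (h : 'I_K -> B -> B) : cartier_subalgebra p D ->
  (forall i, D e.+1 (h i)) ->
  (forall f, D e.+1 f -> exists r : 'I_K -> B, f = (fun x => \sum_i h i (r i * x))) ->
  extends_by id (fun f g => f \o g) D e.+1 K.
Proof.
move=> [_ _ D0 _] Dh Dspan; exists h; split=> // f Df.
have [r ->] := Dspan f Df.
set Y : nat -> set (B -> B) := fun i => [set x | ((i < e.+1)%N /\ D i x) \/
  (i = e.+1 /\ exists j, h j = x)]; rewrite -/Y.
have gY := subring_gen_graded id (fun f g : B -> B => f \o g) Y.
have -> : (fun x => \sum_i h i (r i * x)) = \sum_i (h i \o (fun x => r i * x)).
  by apply/funext => x; rewrite fct_sumE.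
apply: (graded_subring_sum _ gY) => i; rewrite -[e.+1]addn0; case: (gY) => _ _ _; apply.
  by apply: sub_subring_gen; right; split=> //; exists i.
by apply: sub_subring_gen; left; split=> //; rewrite D0; exists (r i).
Qed.

(** * Full modules of p^-e-linear maps over the local ring *)

Section CoefficientTrace.
Variables (k : fieldType) (p : nat).
Hypotheses (char_k : p \in [pchar k]) (k_Ffin : F_finite p k).

Let frobpD : {morph (fun x : k => x ^+ p) : x y / x + y}.
Proof. by have := frobD 1 char_k char_k; rewrite expn1. Qed.

Let frobp0 : (0 : k) ^+ p = 0.
Proof. by rewrite expr0n gtn_eqF // prime_gt0 // (pcharf_prime char_k). Qed.

Let frobpN x : (- x : k) ^+ p = - x ^+ p.
Proof. by apply: (addrI (x ^+ p)); rewrite -frobpD !subrr frobp0. Qed.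

Definition frob_spanning m (b : 'I_m -> k) : Prop :=
  forall a, exists c : 'I_m -> k, a = \sum_i c i ^+ p * b i.

(** A relation with [d j != 0] expresses [b j] by the other members of the family. *)
Lemma frob_spanning_drop m (b d : 'I_m.+1 -> k) j : frob_spanning b ->
  \sum_i d i ^+ p * b i = 0 -> d j != 0 -> frob_spanning (b \o lift j).
Proof.
move=> span_b; rewrite (bigD1_ord j) //= => /eqP; rewrite addr_eq0 => /eqP E dj a.
have [c ->] := span_b a.
exists (fun i => c (lift j i) - c j / d j * d (lift j i)).
rewrite (bigD1_ord j) //= (_ : c j ^+ p * b j = (c j / d j) ^+ p * (d j ^+ p * b j)).
  rewrite E mulrN mulr_sumr -sumrN -big_split /=; apply: eq_bigr => i _.
  rewrite frobpD frobpN [(_ / _ * _) ^+ p]exprMn; ring.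
by rewrite mulrA -exprMn divfK.
Qed.

(** A coordinate with respect to a basis of [k] over [k^p], that is, to a shortest
    spanning family, followed by the [p]-th root. *)
Lemma coefficient_trace : exists tau : k -> k,
  [/\ {morph tau : x y / x + y}, forall c x, tau (c ^+ p * x) = c * tau x &
      exists x, tau x = 1].
Proof.
have ex : exists m, `[< exists b : 'I_m -> k, frob_spanning b >].
  by case: k_Ffin => m [b Hb]; exists m; apply/asboolP; exists b.
case: (ex_minnP ex) => -[|m] /asboolP[b span_b] bmin.
  have [c] := span_b 1; rewrite big_ord0 => /eqP; by rewrite oner_eq0.
have uniq_b c c' : \sum_i c i ^+ p * b i = \sum_i c' i ^+ p * b i -> c =1 c'.
  move=> E j; apply/eqP; rewrite -subr_eq0; apply: contraT => dj.
  have : (m.+1 <= m)%N; last by rewrite ltnn.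
  apply: bmin; apply/asboolP; exists (b \o lift j).
  apply: (@frob_spanning_drop _ b (fun i => c i - c' i)) => //.
  under eq_bigr do rewrite frobpD frobpN mulrBl.
  by rewrite sumrB E subrr.
have [co coE] := choice span_b.
exists (fun x => co x ord0); split.
- move=> x y; apply: (uniq_b _ (fun i => co x i + co y i)).
  under [RHS]eq_bigr do rewrite frobpD mulrDl.
  by rewrite big_split /= -!coE.
- move=> c x; apply: (uniq_b _ (fun i => c * co x i)).
  under [RHS]eq_bigr do rewrite exprMn -mulrA.
  by rewrite -mulr_sumr -!coE.
- exists (b ord0); rewrite (uniq_b _ (fun i => (i == ord0)%:R)) ?eqxx //.
  rewrite -coE (bigD1 ord0) //= expr1n mul1r big1 ?addr0 // => i /negPf ->.
  by rewrite frobp0 mul0r.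
Qed.

End CoefficientTrace.

Section FractionTrace.
Variables (A : comPzRingType) (p : nat) (phi : A -> A).
Hypotheses (p_gt0 : (0 < p)%N) (phiD : {morph phi : f g / f + g})
  (phiM : forall f r, phi (f ^+ p * r) = f * phi r).

(** A [p^-1]-linear map extends to fractions by
    [phi (f / g) = phi (f g^(p-1)) / g]. *)
Definition frac_numer (f g : A) : A := phi (f * g ^+ p.-1).

Let expp (x : A) : x ^+ p = x * x ^+ p.-1.
Proof. by rewrite -exprS prednK. Qed.

Lemma frac_numer_cross f g f' g' : f * g' = f' * g ->
  frac_numer f g * g' = frac_numer f' g' * g.
Proof.
move=> cross; rewrite /frac_numer [LHS]mulrC [RHS]mulrC -!phiM; congr (phi _).
rewrite !expp; transitivity (f * g' * (g ^+ p.-1 * g' ^+ p.-1)); first by ring.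
by rewrite cross; ring.
Qed.

Lemma frac_numerD f g f' g' : frac_numer (f * g' + f' * g) (g * g') =
  frac_numer f g * g' + frac_numer f' g' * g.
Proof.
rewrite /frac_numer [X in _ = X + _]mulrC [X in _ = _ + X]mulrC -!phiM -phiD; congr (phi _).
by rewrite exprMn !expp; ring.
Qed.

Lemma frac_numerM f g f' g' : frac_numer (f' ^+ p * f) (g' ^+ p * g) =
  f' * (g' ^+ p.-1 * frac_numer f g).
Proof.
rewrite /frac_numer -!phiM; congr (phi _).
by rewrite !exprMn -!exprM [(p * _)%N]mulnC; ring.
Qed.

End FractionTrace.

Section SplitTrace.
Variables (n : nat) (k : fieldType) (p : nat).
Hypotheses (char_k : p \in [pchar k]) (k_Ffin : F_finite p k).
Local Notation T := (mpoly.mpoly n k).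
Local Notation S := (local_ring n k).
Local Notation m0 := (@irrelevant_ideal n k).
Local Notation loc := (@loc_of n k).

Let p_gt0 : (0 < p)%N. Proof. exact: prime_gt0 (pcharf_prime char_k). Qed.

Definition all_vars : multinom n := Multinom [tuple 1%N | i < n].

(** Read off the [k[X^p]]-linear trace, then apply [tau] to the coefficients. *)
Lemma polynomial_split_trace : exists phi : T -> T,
  [/\ {morph phi : f g / f + g}, forall f r, phi (f ^+ p * r) = f * phi r &
      exists c, phi (c *: mpolyX k all_vars ^+ p.-1) = 1].
Proof.
have [tau [tauD tauM [c tauc]]] := coefficient_trace char_k k_Ffin.
pose tauT : T -> T := monext tau (mpolyX k).
have tauTD : {morph tauT : f g / f + g} by exact: monextD.
have tauTM f r : tauT (ftwist p 1 f * r) = f * tauT r.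
  pose G f := tauT (ftwist p 1 f * r); pose H f := f * tauT r.
  suff : G =1 H by apply.
  apply: mpoly_ext_additive => [x y|x y|a u]; rewrite /G /H.
  - by rewrite ftwistD // mulrDl tauTD.
  - by rewrite mulrDl.
  rewrite ftwistX //.
  apply: (@mpoly_ext_additive _ _ _
    (fun r => tauT (a ^+ (p ^ 1) *: mpolyX k u * r)) (fun r => a *: mpolyX k u * tauT r)).
  - by move=> x y; rewrite mulrDr tauTD.
  - by move=> x y; rewrite tauTD mulrDr.
  move=> a' v; rewrite -!scalerAl -!scalerAr scalerA -mpolyXD /tauT !monextX //.
  by rewrite expn1 tauM -scalerAr scalerA mpolyXD.
exists (fun f => tauT (ptrace p 1 f)); split.
- by move=> f g; rewrite ptraceD tauTD.
- by move=> f r; rewrite mulrC -{1}(expn1 p) ptrace_mul // tauTM.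
exists c; rewrite mpolyXn ptraceX.
have -> : tr_exact p 1 (mnm_muln all_vars p.-1).
  apply/forallP => i; rewrite mulmnE mnmE mul1n expn1 modn_small //.
  by rewrite prednK.
rewrite /tauT monextX // tauc scale1r (_ : tr_mon _ _ _ = @mnm0 n) ?mpolyX0 //.
apply/mnmP => i; rewrite mnm0E mnmE mulmnE mnmE mul1n expn1 divn_small //.
by rewrite prednK.
Qed.

Lemma loc_cancel g (x y : S) : ~ m0 g -> x * loc g = y * loc g -> x = y.
Proof.
by move=> gm; have [z zg] := loc_unit gm; move=> /(congr1 ( *%R^~ z)); rewrite -!mulrA [loc g * z]mulrC zg !mulr1.
Qed.

(** [z], the image of [x_1 ... x_n]; [z ^+ (q - 1)] spans the socle modulo
    [(x_1^q, ..., x_n^q)] and detects generators of [Hom(^e S, S)]. *)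
Definition loc_vars : S := loc (mpolyX k all_vars).

Definition split_at_socle (e : nat) (phi : S -> S) : Prop :=
  exists c, phi (c * loc_vars ^+ (p ^ e).-1) = 1.

Lemma local_split_trace :
  exists phi : S -> S, hom_frob p 1 phi /\ split_at_socle 1 phi.
Proof.
have [phi0 [phi0D phi0M [c phi0c]]] := polynomial_split_trace.
have loc_phi (x : S) : exists y : S, forall f g, ~ m0 g -> x * loc g = loc f ->
    y * loc g = loc (frac_numer p phi0 f g).
  have [f0 [g0 [gm0 E0]]] := loc_frac x; have [z zg0] := loc_unit gm0.
  exists (z * loc (frac_numer p phi0 f0 g0)) => f g gm E.
  have cross : f0 * g = f * g0 by apply: loc_inj; rewrite !locM -E -E0 mulrAC.
  apply: (loc_cancel gm0); rewrite -[_ * loc g]mulrA -locM.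
  by rewrite (frac_numer_cross p_gt0 phi0M cross) locM mulrCA zg0 mulr1.
have [phi phiE] := choice loc_phi.
have phi_loc f : phi (loc f) = loc (phi0 f).
  have := phiE (loc f) f 1 (@nirrelevant1 n k).
  by rewrite /frac_numer loc1 !mulr1 expr1n mulr1; exact.
exists phi; split; first split.
- move=> x x'; have [f [g [gm E]]] := loc_frac x; have [f' [g' [gm' E']]] := loc_frac x'.
  have Esum : (x + x') * loc (g * g') = loc (f * g' + f' * g).
    by rewrite locD !locM -E -E' mulrDl mulrA [loc g * _]mulrC mulrA.
  apply: (loc_cancel (nirrelevantM gm gm')).
  rewrite (phiE _ _ _ (nirrelevantM gm gm') Esum) frac_numerD // locD !locM.
  by rewrite -(phiE _ _ _ gm E) -(phiE _ _ _ gm' E') mulrDl mulrA [loc g * _]mulrC mulrA.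
- move=> r x; rewrite expn1.
  have [f [g [gm E]]] := loc_frac x; have [f' [g' [gm' E']]] := loc_frac r.
  have gm'' : ~ m0 (g' ^+ p * g).
    apply: nirrelevantM => //; elim: (p) => [|i IH]; first exact: nirrelevant1.
    by rewrite exprS; exact: nirrelevantM.
  have Emul : r ^+ p * x * loc (g' ^+ p * g) = loc (f' ^+ p * f).
    by rewrite !locM !locX -E -E' exprMn mulrACA.
  apply: (loc_cancel gm''); rewrite (phiE _ _ _ gm'' Emul) frac_numerM //.
  rewrite !locM -(phiE _ _ _ gm E) -E' [RHS]mulrACA.
  by rewrite -[in loc (g' ^+ p)](prednK p_gt0) exprS locM !mulrA.
exists (loc (mpolyC n c)); rewrite /loc_vars -locX -locM expn1 phi_loc mul_mpolyC phi0c.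
exact: loc1.
Qed.

Lemma hom_frob_comp e e' (phi psi : S -> S) : hom_frob p e phi -> hom_frob p e' psi ->
  hom_frob p (e + e') (phi \o psi).
Proof.
move=> [phiD phiM] [psiD psiM]; split=> [x y|r x] /=.
  by rewrite psiD phiD.
by rewrite expnD exprM psiM phiM.
Qed.

Lemma split_at_socle_comp e e' (phi psi : S -> S) : hom_frob p e phi ->
  hom_frob p e' psi -> split_at_socle e phi -> split_at_socle e' psi ->
  split_at_socle (e + e') (phi \o psi).
Proof.
move=> _ [_ psiM] [c Hc] [c' Hc'].
exists (c ^+ (p ^ e') * c'); rewrite /= (_ : _ * _ * _ =
    (c * loc_vars ^+ (p ^ e).-1) ^+ (p ^ e') * (c' * loc_vars ^+ (p ^ e').-1)).
  by rewrite psiM Hc' mulr1.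
rewrite exprMn -exprM [RHS]mulrACA -exprD; congr (_ * _ ^+ _).
have q0 : (0 < p ^ e)%N by rewrite expn_gt0 p_gt0.
have q1 : (0 < p ^ e')%N by rewrite expn_gt0 p_gt0.
rewrite expnD; move: (p ^ e)%N (p ^ e')%N q0 q1 => q q' q0 q'0.
by rewrite -[q in LHS](prednK q0) mulSn addnC -[q' in (_ + q')%N](prednK q'0) addnS.
Qed.

Lemma exists_split_at_socle e : exists phi : S -> S,
  hom_frob p e phi /\ split_at_socle e phi.
Proof.
elim: e => [|e [phi [phi_hom phi_split]]].
  exists id; split; last by exists 1; rewrite expn0 expr0 mulr1.
  by split=> // r x; rewrite expn0 expr1.
have [psi [psi_hom psi_split]] := local_split_trace.
rewrite -addn1; exists (phi \o psi); split; first exact: hom_frob_comp.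
exact: split_at_socle_comp.
Qed.

(** A map that takes the value [1] on [S z^(q-1)] is a generator. Indeed, if
    [phi = Tr(s -)] with [s] in the maximal ideal, write [s] as a
    combination of the [x_i]; as [x_i z^(q-1)] is a multiple of [x_i^q], the map
    [phi] sends [S z^(q-1)] into the maximal ideal; so [s] is a unit. *)
Lemma split_at_socle_generates e (tr phi : S -> S) : frob_generator p e tr ->
  hom_frob p e phi -> split_at_socle e phi ->
  exists s, forall u, tr u = phi (s * u).
Proof.
move=> [tr_hom tr_gen] phi_hom [c phic].
have [s phiE] := tr_gen _ phi_hom.
have Im0 := graded_ideal (irrelevant_graded n k).
have Ie : is_ideal (extension m0) := ideal_gen_is_ideal _.
have [f [g [gm E]]] := loc_frac s.
have fm : ~ m0 f.
  move=> mf; have ms : extension m0 s by apply/extension_frac => //; exists f, g.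
  pose B := [set s | forall u, extension m0 (tr (s * u * loc_vars ^+ (p ^ e).-1))].
  have [trD trM] := tr_hom; have tr0 := hom_frob0 tr_hom.
  have IB : is_ideal B.
    split; first by move=> u; rewrite !mul0r tr0; exact: ideal0.
      by move=> x y Bx By u; rewrite !mulrDl trD; apply: (idealD Ie); [exact: Bx | exact: By].
    by move=> r x Bx u; rewrite [r * x]mulrC -[x * r * u]mulrA; exact: Bx.
  have /(_ _ ms c) : extension m0 `<=` B.
    apply: ideal_gen_sub => // _ [h mh <-]; move: h mh.
    have IB' : is_ideal [set h | B (loc h)].
      split; first by rewrite /= loc0; exact: ideal0.
        by move=> x y /=; rewrite locD; exact: idealD.
      by move=> r x /=; rewrite locM; exact: idealM.
    apply: (ideal_gen_sub IB') => _ [i _ <-] u /=.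
    pose w : multinom n := Multinom [tuple (if j == i then 0 else (p ^ e).-1)%N | j < n].
    have -> : loc (mpolyX k (mnm1 i)) * u * loc_vars ^+ (p ^ e).-1 =
        loc (mpolyX k (mnm1 i)) ^+ (p ^ e) * (u * loc (mpolyX k w)).
      rewrite /loc_vars -!locX !mpolyXn mulrAC -locM -mpolyXD mulrCA -locM -mpolyXD.
      rewrite mulrC; congr (_ * loc (mpolyX k _)); apply/mnmP => j.
      have q0 : (0 < p ^ e)%N by rewrite expn_gt0 p_gt0.
      rewrite !mnmDE !mulmnE !mnmE eq_sym; case: eqP => _; last by rewrite !mul1n.
      by rewrite !mul1n addn0 add1n prednK.
    rewrite trM; apply: idealMr => //; apply: sub_ideal_gen.
    by exists (mpolyX k (mnm1 i)) => //; apply: sub_ideal_gen; exists i.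
  rewrite -mulrA -phiE phic -loc1 => /(extension_contract (irrelevant_graded n k)).
  exact: nirrelevant1.
have [y yf] := loc_unit fm; exists (loc g * y) => u.
by rewrite phiE !mulrA E [loc f * y]mulrC yf mul1r.
Qed.

End SplitTrace.

(** A set of degrees closed under adding [e0] is, in large degrees, also closed
    under subtracting it: argue in each residue class modulo [e0]. *)
Lemma eventually_predecessor (P : nat -> Prop) e0 : (0 < e0)%N ->
  (forall e, P e -> P (e + e0)%N) ->
  exists M, forall e, (M <= e)%N -> P e -> (e0 <= e)%N /\ P (e - e0)%N.
Proof.
move=> e00 Pe0.
have /choice[N HN] : forall r : 'I_e0, exists N,
    (exists j, P (r + j * e0)%N) -> P (r + N * e0)%N.
  move=> r; have [[j Pj]|nj] := pselect (exists j, P (r + j * e0)%N).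
    by exists j.
  by exists 0%N.
exists ((\sum_r N r + 2) * e0)%N => e Me Pe.
pose r := Ordinal (ltn_pmod e e00).
have Nr : (N r <= \sum_r N r)%N by rewrite (bigD1 r) //= leq_addr.
have eE : e = (r + (e %/ e0) * e0)%N by rewrite addnC -divn_eq.
have je : (\sum_r N r + 2 <= e %/ e0)%N by rewrite leq_divRL.
split; first by apply: leq_trans Me; rewrite leq_pmull // addn2.
have -> : (e - e0 = r + N r * e0 + ((e %/ e0).-1 - N r) * e0)%N.
  rewrite -addnA -mulnDl subnKC; last by lia.
  by rewrite {1}eE -[in LHS](prednK (_ : 0 < e %/ e0)%N) ?mulSn; lia.
have : P (r + N r * e0)%N by apply: HN; exists (e %/ e0)%N; rewrite -eE.
elim: (_ - _)%N => [|j IH] PN; first by rewrite mul0n addn0.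
by rewrite mulSn [(e0 + _)%N]addnC addnA; apply: Pe0; exact: IH.
Qed.

Section FullDegrees.
Variables (n : nat) (k : fieldType) (p : nat).
Hypotheses (char_k : p \in [pchar k]) (k_Ffin : F_finite p k).
Local Notation T := (mpoly.mpoly n k).
Local Notation S := (local_ring n k).
Variables (J : set T) (D : nat -> set (quotient_local_ring J -> quotient_local_ring J)).
Hypothesis D_cartier : cartier_subalgebra p D.
Variables (Tr : nat -> S -> S) (JD : nat -> set S).
Hypothesis Tr_gen : forall e, frob_generator p e (Tr e).
Hypothesis JD_fedder : forall e, fedder_ideal p e (Tr e) (D e) (JD e).
Local Notation pi := (@quot_pi S (@loc_of n k @` J)).

(** When [J_e = S], every element of [Hom(^e S, S)] descends to [D_e]. *)
Lemma full_induced e phi : JD e 1 -> hom_frob p e phi ->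
  exists2 f, D e f & forall u, f (pi u) = pi (phi u).
Proof.
move=> JD1 phi_hom; have [s phiE] := (Tr_gen e).2 _ phi_hom.
have Js : JD e s by case: (JD_fedder e) => IJ _ _ _; rewrite -[s]mulr1; exact: idealM.
have [f Df fE] := induced_map (Tr_gen e).1 (JD_fedder e) Js.
by exists f => // u; rewrite fE phiE.
Qed.

Lemma full_surjective e : JD e 1 -> exists2 f, D e f & forall y, exists x, f x = y.
Proof.
move=> JD1; have [phi [phi_hom [c phic]]] := exists_split_at_socle n char_k k_Ffin e.
have [f Df fE] := full_induced JD1 phi_hom; exists f => // y.
have [u ->] := quot_pi_surj y.
exists (pi (u ^+ (p ^ e) * (c * loc_vars n k ^+ (p ^ e).-1))).
by rewrite fE; case: phi_hom => _ ->; rewrite phic mulr1.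
Qed.

(** Composing maps that are split at the socle gives a generator of
    [Hom(^(e+e') S, S)], so [D_(e+e')] consists of products. *)
Lemma full_product e e' : (0 < e)%N -> (0 < e')%N -> JD e 1 -> JD e' 1 ->
  extends_by id (fun f g => f \o g) D (e + e') 0.
Proof.
move=> e0 e'0 JD1 JD1'; exists (fun=> 0); split=> [[]//|f].
have [phi [phi_hom phi_split]] := exists_split_at_socle n char_k k_Ffin e.
have [psi [psi_hom psi_split]] := exists_split_at_socle n char_k k_Ffin e'.
have [s TrE] := split_at_socle_generates char_k (Tr_gen (e + e'))
  (hom_frob_comp phi_hom psi_hom)
  (split_at_socle_comp char_k phi_hom psi_hom phi_split psi_split).
case: (JD_fedder (e + e')) => _ _ _ <- [s' _ fE].
have [g Dg gE] := full_induced JD1 phi_hom.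
have psis_hom : hom_frob p e' (fun u => psi (s * s' * u)).
  case: psi_hom => psiD psiM; split=> [x y|r x]; first by rewrite mulrDr psiD.
  by rewrite mulrCA psiM.
have [h Dh hE] := full_induced JD1' psis_hom.
have -> : f = g \o h.
  apply/funext => x; have [u ->] := quot_pi_surj x.
  by rewrite fE TrE /= hE gE mulrA.
set Y : nat -> set (quotient_local_ring J -> quotient_local_ring J) := fun i => _.
have [_ _ _ YM] := subring_gen_graded id
  (fun f g : quotient_local_ring J -> quotient_local_ring J => f \o g) Y.
by apply: YM; apply: sub_subring_gen; left; split=> //; lia.
Qed.

(** A non-zero [D_e] of large degree is full, and composing with a surjective
    element of a fixed full [D_e0] shows that the large degrees with [D_e] non-zero
    are closed under adding [e0]. So such a degree is the sum of [e0] and a smaller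
    one, and [full_product] applies. *)
Lemma eventually_generated E :
  (forall e, (E <= e)%N -> JD e 1 \/ D e `<=` [set 0]) ->
  exists M, forall e, (M <= e)%N -> extends_by id (fun f g => f \o g) D e 0.
Proof.
move=> dich.
have zero_ext e : D e `<=` [set 0] -> extends_by id (fun f g => f \o g) D e 0.
  exact: extends_by_zero.
pose nz e := exists2 f, D e f & f <> 0.
have Dnz e : ~ nz e -> D e `<=` [set 0].
  by move=> ne f Df; apply: contrapT => f0; apply: ne; exists f.
have [[e0 [Ee0 [e00 nz0]]]|none] := pselect (exists e, (E <= e)%N /\ (0 < e)%N /\ nz e);
    last first.
  exists E.+1 => e Ee; apply/zero_ext/Dnz => nze; apply: none; exists e.
  by rewrite (ltnW Ee) (leq_trans _ Ee).
have full e : (E <= e)%N -> nz e -> JD e 1.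
  move=> /dich[//|De0] [f /De0 f0]; by move/(_ f0).
have [sur Dsur surP] := full_surjective (full _ Ee0 nz0).
have nz_add e : nz e -> nz (e + e0)%N.
  move=> [f Df f0]; exists (f \o sur); first by case: D_cartier => _ [_ _ _ DM] _ _; exact: DM.
  move=> H; apply: f0; apply/funext => y; have [x <-] := surP y.
  by move: (congr1 (@^~ x) H).
have [M HM] := eventually_predecessor e00 nz_add.
exists (maxn M (E + e0).+1) => e; rewrite geq_max => /andP[Me Ee].
have [nze|/Dnz/zero_ext//] := pselect (nz e).
have [e0e nzpred] := HM e Me nze; rewrite -(subnK e0e).
have lt : (E + e0 < e)%N := Ee.
by apply: full_product => //; try apply: full => //; lia.
Qed.

End FullDegrees.

(** * Lowest degrees, generating degrees and exponents *)

Section LowestDegree.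
Variables (n : nat) (k : fieldType) (p e : nat).
Local Notation T := (mpoly.mpoly n k).
Local Notation hc := (pihomog (@mdeg n)).
Local Notation q := (p ^ e)%N.
Implicit Types (J : set T) (f g : T).

Definition high (d : nat) : set T := [set f | forall i, (i < d)%N -> hc i f = 0].

Lemma highM d d' f g : high d f -> high d' g -> high (d + d') (f * g).
Proof.
move=> hf hg i id; rewrite hcM big1 // => j _.
have [jd|dj] := ltnP j d; first by rewrite hf ?mul0r.
by rewrite [hc (i - j) g]hg ?mulr0 // ltn_subLR ?(leq_trans id) ?leq_add2r // -ltnS ltn_ord.
Qed.

Lemma high0 f : high 0 f. Proof. by []. Qed.

Lemma highX d f i : high d f -> high (i * d) (f ^+ i).
Proof.
move=> hf; elim: i => [|i IH]; first exact: high0.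
by rewrite exprS mulSn; exact: highM.
Qed.

Lemma high_ideal d : is_ideal (high d).
Proof.
split; first by move=> i _; rewrite raddf0.
  by move=> f g hf hg i id; rewrite raddfD /= hf ?hg ?addr0.
by move=> r f hf; rewrite -(add0n d); apply: highM.
Qed.

Lemma high_msize d f : high d f -> f != 0 -> (d < mmeasure (@mdeg n) f)%N.
Proof.
move=> hf f0; rewrite -(mlead_deg f0) ltnS leqNgt; apply/negP => lt.
have := congr1 (mcoeff (mlead f)) (hf _ lt); rewrite mcoeff_hc eqxx mcoeff0 => /eqP.
by rewrite mleadc_eq0 (negPf f0).
Qed.

(** If [delta] is the least degree in [J], then [J^[q]] starts in degree
    [q delta], so a non-zero multiplier of [J] into [J^[q]] has degree at
    least [(q - 1) delta]. *)
Lemma colon_frob_power_degree J f : graded J -> ~ J 1 -> (exists2 h, J h & h <> 0) ->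
  colon (frob_power p e J) J f -> f != 0 -> (q <= mmeasure (@mdeg n) f)%N.
Proof.
move=> gJ J1 [h0 Jh0 h0n] cf f0.
have ex : exists i, `[< exists2 h, J h & hc i h <> 0 >].
  apply: contrapT => H; apply: h0n; rewrite (hc_sum (leqnn (mmeasure (@mdeg n) h0))).
  apply: big1 => i _; apply: contrapT => hi; apply: H; exists i; apply/asboolP.
  by exists h0.
case: (ex_minnP ex) => delta /asboolP[h1 Jh1 hd] dmin.
have Jhigh : J `<=` high delta.
  move=> f' Jf' i id; apply: contrapT => ne; have := dmin i; rewrite leqNgt id.
  by move=> H; have : false by apply: H; apply/asboolP; exists f'.
have Fhigh : frob_power p e J `<=` high (q * delta).
  apply: ideal_gen_sub; first exact: high_ideal.
  by move=> _ [f' Jf' <-]; apply: highX; exact: Jhigh.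
have d0 : (0 < delta)%N.
  rewrite lt0n; apply/eqP => d0; apply: J1; move: hd (gradedP delta gJ Jh1).
  rewrite d0 hc0; set c := mcoeff _ _ => cn Jc.
  have c0 : c != 0 by apply/eqP => E; apply: cn; rewrite E mpolyC0.
  have := ideal_scale c^-1 (graded_ideal gJ) Jc.
  by rewrite -mul_mpolyC -mpolyCM mulVf.
have h0' : hc delta h1 != 0 by apply/eqP.
have := high_msize (Fhigh _ (cf _ (gradedP delta gJ Jh1))).
rewrite mulf_neq0 // => /(_ isT); rewrite msizeM // -(mlead_deg h0').
rewrite (dhomogP _ _ _ (pihomogP _ delta h1) _ (mlead_supp h0')) /= addnS /=.
have f1 : (0 < mmeasure (@mdeg n) f)%N by rewrite lt0n mmeasure_poly_eq0.
move: (mmeasure _ f) f1 => s s1 H.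
have [//|sq] := leqP q s.
have : (s.-1 * delta + delta <= q.-1 * delta + delta)%N by rewrite leq_add2r leq_mul2r; lia.
nia.
Qed.

End LowestDegree.

Section GeneratingDegree.
Variables (n : nat) (k : fieldType) (rT : realType).
Local Notation T := (mpoly.mpoly n k).

Lemma gen_degree_lt (a : set T) (B : rT) : is_ideal a -> (gen_degree rT a < B%:E)%E ->
  exists d : nat, a = ideal_gen [set f | a f /\ low d.+1 f] /\
                  (d = 0%N \/ d%:R < B).
Proof.
move=> Ia /ereal_inf_lt[_ [m aE <-]]; rewrite lte_fin => mB.
exists `|Num.max m 0|%N; split.
  apply/seteqP; split; last by apply: ideal_gen_sub => // f [].
  rewrite {1}aE; apply: ideal_gen_mono => f [af fm]; apply: sub_ideal_gen; split=> //.
  have [->|f0] := eqVneq f 0; first exact: low0.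
  rewrite /low/= -(mlead_deg f0) ltnS -lez_nat gez0_abs ?le_max ?lexx ?orbT //.
  by rewrite fm // mlead_supp.
have [m0|m0] := leP m 0; first by left.
right; move: mB; rewrite -[m in m%:~R]gez0_abs ?ltW //.
Qed.

End GeneratingDegree.

Section Exponent.
Variables (rT : realType) (p : nat) (B : comPzRingType) (D : nat -> set (B -> B)).
Hypotheses (p_prime : prime p) (D_cartier : cartier_subalgebra p D).
Local Notation ext e K := (extends_by id (fun f g => f \o g) D e K).

Let gD : graded_subring id (fun f g => f \o g) D. Proof. by case: D_cartier. Qed.

Let lnp_gt0 : 0 < ln (p%:R : rT).
Proof. by rewrite ln_gt0 // ltr1n prime_gt1. Qed.

Hypothesis D_fin : forall e, exists K, ext e.+1 K.

Lemma complexity_bound (N C : rT) E : 0 < N ->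
  (forall e, (E <= e)%N -> exists2 K, ext e K & K%:R <= C * N ^+ e) ->
  (complexity id (fun f g => f \o g) rT D <= N%:E)%E.
Proof.
move=> N0 H; apply: (complexity_le (C := C)) => //.
exists E.+1 => // -[//|e] /= Ee.
have [K HK HC] := H e.+1 (ltnW Ee).
apply: le_trans (gen_number_diff rT gD D_fin HK) _.
by rewrite lee_fin.
Qed.

Lemma frob_exponent_le (s C : rT) E :
  (forall e, (E <= e)%N -> exists2 K, ext e K & K%:R <= C * (p%:R `^ s) ^+ e) ->
  (frob_exponent p rT D <= s%:E)%E.
Proof.
move=> H; have N0 : 0 < (p%:R : rT) `^ s by rewrite powR_gt0 // ltr0n prime_gt0.
have := complexity_bound N0 H; set cx := complexity _ _ _ _ => cxN.
rewrite /frob_exponent /log_complexity lee_pdivrMr // -EFinM -ln_powR -lne_EFin //.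
rewrite lee_lne // in_itv /= leey andbT; last by rewrite lee_fin ltW.
by apply/ereal_infP => _ [N' [N'0 _] <-]; rewrite lee_fin ltW.
Qed.

Lemma frob_exponent_Ny E : (forall e, (E <= e)%N -> ext e 0) ->
  (frob_exponent p rT D = -oo)%E.
Proof.
move=> H; rewrite /frob_exponent /log_complexity le0_lneNy.
  by rewrite gt0_mulNye // lte_fin invr_gt0.
apply/lee_addgt0Pr => N N0; rewrite add0e.
apply: (@complexity_bound N 0 E) => // e Ee; exists 0%N; first exact: H.
by rewrite mul0r.
Qed.

End Exponent.

(** * The number of generators in degree e *)

Section FedderData.
Variables (n : nat) (k : fieldType) (p : nat).
Hypothesis char_k : p \in [pchar k].
Local Notation T := (mpoly.mpoly n k).
Local Notation S := (local_ring n k).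
Local Notation loc := (@loc_of n k).
Variables (J : set T) (D : nat -> set (quotient_local_ring J -> quotient_local_ring J)).
Hypotheses (gJ : graded J) (D_cartier : cartier_subalgebra p D).
Variables (Tr : nat -> S -> S) (JD : nat -> set S) (b : nat -> set T).
Hypotheses (Tr_gen : forall e, frob_generator p e (Tr e))
  (JD_fedder : forall e, fedder_ideal p e (Tr e) (D e) (JD e))
  (gb : forall e, graded (b e)) (JD_ext : forall e, JD e = extension (b e)).
Local Notation ext e K := (extends_by id (fun f g => f \o g) D e K).

Let IJ : is_ideal J := graded_ideal gJ.

(** Over the zero ring every [D_e] vanishes. *)
Lemma fedder_proper : ~ J 1.
Proof.
move=> J1; case: D_cartier => _ _ _ [e _ [f _ f0]]; apply: f0; apply/funext => x.
have triv (y z : quotient_local_ring J) : y = z.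
  have [u ->] := quot_pi_surj y; have [v ->] := quot_pi_surj z; apply/quot_piP.
  rewrite -[_ - _]mulr1 -loc1; apply: idealM; first exact: ideal_gen_is_ideal.
  by apply: sub_ideal_gen; exists 1.
exact: triv.
Qed.

Lemma frob_power_sub_b e : frob_power p e J `<=` b e.
Proof.
move=> f Jf; apply: (extension_contract (gb e)); rewrite -JD_ext.
case: (JD_fedder e) => _ + _ _; apply.
by apply: extension_frob_power => //; exists f.
Qed.

Lemma b_sub_colon e : b e `<=` colon (frob_power p e J) J.
Proof.
move=> f bf y Jy; apply: (extension_contract (frob_power_graded e char_k gJ)).
apply: frob_power_extension => //; rewrite locM.
have Jf : JD e (loc f) by rewrite JD_ext; apply: sub_ideal_gen; exists f.
case: (JD_fedder e) => _ _ /(_ _ Jf) + _; apply.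
by apply: sub_ideal_gen; exists y.
Qed.

(** The elements that the [g i] span modulo [J^[q]] form an ideal, in [T] as well as
    in [S]; so it is enough that they include the generators of [b_e]. *)
Lemma extends_of_span e (X : set T) K (g : 'I_K -> T) : b e.+1 = ideal_gen X ->
  (forall i, b e.+1 (g i)) ->
  (forall f, X f -> exists c : 'I_K -> T, frob_power p e.+1 J (f - \sum_i c i * g i)) ->
  ext e.+1 K.
Proof.
move=> bX bg Xspan.
have If : is_ideal (frob_power p e.+1 (extension J)) := ideal_gen_is_ideal _.
pose Sp (s : S) := exists c : 'I_K -> S,
  frob_power p e.+1 (extension J) (s - \sum_i c i * loc (g i)).
have ISp : is_ideal [set s | Sp s].
  split.
  - by exists (fun=> 0); rewrite big1 ?subr0 => [|i _]; [exact: ideal0 | rewrite mul0r].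
  - move=> x y [c Hc] [c' Hc']; exists (fun i => c i + c' i).
    under eq_bigr do rewrite mulrDl.
    by rewrite big_split opprD addrACA; exact: idealD.
  - move=> r x [c Hc]; exists (fun i => r * c i).
    under eq_bigr do rewrite -mulrA.
    by rewrite -mulr_sumr -mulrBr; exact: idealM.
have Jspan s : JD e.+1 s -> Sp s.
  rewrite JD_ext; suff H : extension (b e.+1) `<=` [set s | Sp s] by exact: H.
  apply: ideal_gen_sub => // _ [f bf <-]; move: f bf.
  have ISp' : is_ideal [set f | Sp (loc f)].
    split; first by rewrite /= loc0; exact: (ideal0 ISp).
      by move=> x y /=; rewrite locD; exact: (idealD ISp).
    by move=> r x /=; rewrite locM; exact: (idealM ISp).
  rewrite bX; apply: (ideal_gen_sub ISp') => f /Xspan[c Hc].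
  exists (fun i => loc (c i)).
  under eq_bigr do rewrite -locM.
  rewrite -(big_morph loc (@locD n k) (@loc0 n k)) -locB.
  by apply: extension_frob_power => //; exists (f - \sum_i c i * g i).
have JDg i : JD e.+1 (loc (g i)) by rewrite JD_ext; apply: sub_ideal_gen; exists (g i).
have [h Dh Dspan] := fedder_span (Tr_gen e.+1).1 (JD_fedder e.+1) JDg Jspan.
exact: cartier_extends_by D_cartier Dh Dspan.
Qed.

Lemma extends_finite e : exists K, ext e.+1 K.
Proof.
have [s bE] := ideal_finitely_generated (graded_ideal (gb e.+1)).
exists (size s); apply: (extends_of_span (g := fun i => nth 0 s i) bE).
  by move=> i; rewrite bE; apply: sub_ideal_gen; rewrite /= mem_nth.
move=> f /= fs; have si : (index f s < size s)%N by rewrite index_mem.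
exists (fun i => (i == Ordinal si)%:R); rewrite (bigD1 (Ordinal si)) //= eqxx mul1r.
rewrite nth_index // big1 ?addr0 ?subrr => [|i /negPf ->]; last by rewrite mul0r.
exact: ideal0 (ideal_gen_is_ideal _).
Qed.

Lemma extends_of_dim e d K : b e.+1 = ideal_gen [set f | b e.+1 f /\ low d f] ->
  dim_le [set f | b e.+1 f /\ low d f] (frob_power p e.+1 J) K ->
  exists2 K', ext e.+1 K' & (K' <= K)%N.
Proof.
move=> bE [m [g [mK gb' gs]]]; exists m => //.
apply: (extends_of_span (g := g) bE) => [i|f /gs[c Hc]]; first by case: (gb' i).
exists (fun i => mpolyC n (c i)).
by under eq_bigr do rewrite mul_mpolyC.
Qed.

Variables (rT : realType) (t C : rT) (E : nat).
Hypothesis d_bound : forall e, (E <= e)%N ->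
  (gen_degree rT (b e) <= (C * p%:R `^ (t * e%:R))%:E)%E.
Variables (dimR H0 : nat).
Hypothesis growth : forall d, dim_le (@low n k d) J (H0 * d.+1 ^ dimR).
Local Notation Q e := ((p%:R : rT) `^ (t * e%:R)).

Let p_gt1 : (1 < p)%N. Proof. exact: prime_gt1 (pcharf_prime char_k). Qed.

Let Q_gt0 e : 0 < Q e. Proof. by rewrite powR_gt0 // ltr0n ltnW. Qed.

Lemma degree_bound e (B : rT) : (E <= e)%N -> C * Q e < B ->
  exists d, b e = ideal_gen [set f | b e f /\ low d.+1 f] /\ (d = 0%N \/ d%:R < B).
Proof.
move=> Ee CB; apply: gen_degree_lt; first exact: graded_ideal.
by apply: le_lt_trans (d_bound Ee) _; rewrite lte_fin.
Qed.

Lemma b_nonzero_degree e d : (exists2 h, J h & h <> 0) ->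
  b e = ideal_gen [set f | b e f /\ low d.+1 f] -> (p ^ e <= d.+1)%N.
Proof.
move=> Jn bE; have [f bf [lf f0]] : exists2 f, b e f & low d.+1 f /\ f != 0.
  apply: contrapT => H; have b0 : b e `<=` [set 0].
    rewrite bE; apply: ideal_gen_sub.
      split=> [//|x y -> ->|r x ->]; first by rewrite /= addr0.
      by rewrite /= mulr0.
    move=> f [bf lf] /=; apply: contrapT => /eqP f0; apply: H.
    by exists f.
  have [h Jh h0] := Jn; have : b e (h ^+ (p ^ e)).
    by apply: frob_power_sub_b; apply: sub_ideal_gen; exists h.
  by move/b0 => /eqP; rewrite expf_eq0 => /andP[_ /eqP].
apply: leq_trans lf.
exact: (colon_frob_power_degree gJ fedder_proper Jn (b_sub_colon bf) f0).
Qed.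

(** The bound [H(n q) H(d / q + n)] of [dim_le_colon]: since [q <= d + 1], the
    factor [q] lost in the first term is regained in the second. *)
Lemma growth_bound_nonzero e d : (p ^ e <= d.+1)%N ->
  dim_le [set f | b e f /\ low d.+1 f] (frob_power p e J)
    (H0 * H0 * ((n + 2) * (n + 3) * d.+1) ^ dimR).
Proof.
move=> qd; have q0 : (0 < p ^ e)%N by rewrite expn_gt0 ltnW.
set N1 := (n * p ^ e).+2; set N2 := ((d + n * p ^ e) %/ p ^ e).+2.
apply: (@dim_le_mono _ _ _ _ (H0 * N1 ^ dimR * (H0 * N2 ^ dimR))).
  rewrite mulnACA leq_mul2l -expnMn leq_exp_base ?orbT //.
  have h1 : (N1 <= (n + 2) * p ^ e)%N by rewrite /N1; nia.
  have h2 : (p ^ e * N2 <= (n + 3) * d.+1)%N.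
    rewrite /N2 mulnC -addn2 mulnDl.
    apply: (@leq_trans (d + n * p ^ e + 2 * p ^ e)%N); last by nia.
    by rewrite leq_add2r leq_trunc_div.
  apply: (@leq_trans ((n + 2) * p ^ e * N2)%N); first by rewrite leq_mul2r h1 orbT.
  by rewrite -!mulnA leq_mul2l h2 orbT.
have Ulow : [set f | b e f /\ low d.+1 f] `<=` low d.+1 by move=> f [].
have Ucolon : [set f | b e f /\ low d.+1 f] `<=` colon (frob_power p e J) J.
  by move=> f [bf _]; exact: b_sub_colon.
exact: (dim_le_colon char_k IJ Ulow Ucolon (growth _) (growth _)).
Qed.

Lemma growth_bound_zero e d : J `<=` [set 0] ->
  dim_le [set f | b e f /\ low d.+1 f] (frob_power p e J) (H0 * d.+2 ^ dimR).
Proof.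
move=> J0; have If : is_ideal (frob_power p e J) := ideal_gen_is_ideal _.
apply: (@dim_le_sub _ _ _ (@low n k d.+1)).
- by move=> c x y; exact: ideal_lin.
- by move=> f [].
have [m [g [mK lg gs]]] := growth d.+1; exists m, g; split=> // f /gs[c Hc].
by exists c; have -> : f - \sum_i c i *: g i = 0 by [exact: J0]; exact: ideal0.
Qed.

Let Q_pow e : Q e ^+ dimR = ((p%:R : rT) `^ (t * dimR%:R)) ^+ e.
Proof.
rewrite -powR_mulrn; last exact: powR_ge0.
rewrite -[RHS]powR_mulrn; last exact: powR_ge0.
rewrite -!powRrM.
by rewrite mulrAC.
Qed.

Lemma expn_ge4 e : (2 <= e)%N -> (4 <= p ^ e)%N.
Proof.
move=> e2; apply: (@leq_trans (p ^ 2)); last by rewrite leq_pexp2l // ltnW.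
by rewrite (leq_sqr 2).
Qed.

(** The additive constants in [q <= d + 1 < C p^(t e) + 2] are absorbed because
    [4 <= q]. *)
Lemma degree_bound_nonzero e : (exists2 h, J h & h <> 0) -> (maxn E 2 <= e)%N ->
  exists d, [/\ b e = ideal_gen [set f | b e f /\ low d.+1 f], (p ^ e <= d.+1)%N &
                d.+1%:R <= 2 * C * Q e].
Proof.
move=> Jn; rewrite geq_max => /andP[Ee e2].
have CB : C * Q e < C * Q e + 1 by rewrite ltrDl.
have [d [bE dB]] := degree_bound Ee CB.
have qd := b_nonzero_degree Jn bE; exists d; split=> //.
have d3 : (3 <= d)%N by have := leq_trans (expn_ge4 e2) qd.
have {}dB : d%:R < C * Q e + 1 by case: dB => // d0; rewrite d0 in d3.
have {}d3 : 3 <= d%:R :> rT by rewrite (ler_nat rT 3).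
rewrite -addn1 natrD -mulrA; lra.
Qed.

(** If [t < 0], then [p^e <= d_e + 1] would stay bounded. *)
Lemma t_ge0 : (exists2 h, J h & h <> 0) -> 0 <= t.
Proof.
move=> Jn; rewrite leNgt; apply/negP => t0.
pose e := (maxn E 2 + Num.bound (2 * C))%N.
have [d [_ qd dQ]] := @degree_bound_nonzero e Jn (leq_addr _ _).
have Q1 : Q e <= 1.
  rewrite -[leRHS](powRr0 p%:R) ler_powR ?ler1n 1?ltnW //.
  by rewrite mulr_le0_ge0 // ltW.
have qQ : (p ^ e)%N%:R <= 2 * C * Q e by apply: le_trans dQ; rewrite ler_nat.
have C0 : 0 <= 2 * C.
  have : 0 <= 2 * C * Q e by apply: le_trans qQ.
  by rewrite pmulr_lge0.
have eC : (p ^ e)%N%:R <= 2 * C by apply: (le_trans qQ); rewrite ler_piMr.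
have := le_lt_trans eC (archi_boundP C0); rewrite ltr_nat ltnNge.
by rewrite (leq_trans _ (ltnW (ltn_expl e p_gt1))) // leq_addl.
Qed.

Lemma extends_nonzero e : (exists2 h, J h & h <> 0) -> (maxn E 2 <= e)%N ->
  exists2 K, ext e K & K%:R <=
    (H0 ^ 2)%:R * (((n + 2) * (n + 3))%:R * (2 * C)) ^+ dimR *
    ((p%:R : rT) `^ (t * dimR%:R)) ^+ e.
Proof.
move=> Jn; case: e => [|e] Ee; first by move: Ee; rewrite geq_max andbF.
have [d [bE qd dQ]] := degree_bound_nonzero Jn Ee.
have [K HK Kle] := extends_of_dim bE (growth_bound_nonzero qd).
exists K => //; rewrite -mulrA -Q_pow -exprMn -mulrA.
apply: (@le_trans _ _ (H0 * H0 * ((n + 2) * (n + 3) * d.+1) ^ dimR)%N%:R).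
  by rewrite ler_nat.
rewrite natrM mulnn ler_wpM2l // natrX lerXn2r ?nnegrE //.
  by apply: mulr_ge0 => //; apply: le_trans dQ.
by rewrite natrM ler_wpM2l.
Qed.

Lemma extends_zero e : J `<=` [set 0] -> 0 <= t -> (E < e)%N ->
  exists2 K, ext e K & K%:R <=
    H0%:R * (`|C| + 3) ^+ dimR * ((p%:R : rT) `^ (t * dimR%:R)) ^+ e.
Proof.
move=> J0 t0; case: e => // e Ee.
have CB : C * Q e.+1 < C * Q e.+1 + 1 by rewrite ltrDl.
have [d [bE dB]] := degree_bound (ltnW Ee) CB.
have Q1 : 1 <= Q e.+1.
  by rewrite -[X in X <= _](powRr0 p%:R) ler_powR ?mulr_ge0 // ler1n ltnW.
have dQ : d.+2%:R <= (`|C| + 3) * Q e.+1.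
  have dB' : d%:R <= (`|C| + 1) * Q e.+1.
    case: dB => [->|/ltW dB]; first by rewrite mulr_ge0 ?addr_ge0 // ltW.
    apply: le_trans dB _; rewrite mulrDl mul1r lerD // ler_wpM2r ?ler_norm // ltW.
  rewrite -addn2 natrD (_ : _ + 3 = `|C| + 1 + 2); last by ring.
  by rewrite [leRHS]mulrDl lerD // ler_peMr.
have [K HK Kle] := extends_of_dim bE (growth_bound_zero e.+1 d J0).
exists K => //; rewrite -mulrA -Q_pow -exprMn.
apply: (@le_trans _ _ (H0 * d.+2 ^ dimR)%N%:R); first by rewrite ler_nat.
by rewrite natrM ler_wpM2l // natrX lerXn2r ?nnegrE.
Qed.

(** When [t < 0], eventually [d_e <= 0], so [b_e] is [0] or contains [1]. *)
Lemma eventually_trivial : J `<=` [set 0] -> t < 0 ->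
  exists E', forall e, (E' <= e)%N -> JD e 1 \/ D e `<=` [set 0].
Proof.
move=> J0 t0.
have [E1 HE1] : exists E1, forall e, (E1 <= e)%N -> C * Q e < 1.
  pose j := Num.bound ((- t)^-1); pose M := Num.bound `|C|.
  exists (j * M)%N => e je.
  have tj : 1 <= - t * j%:R.
    rewrite -ler_pdivrMl ?oppr_gt0 // mulr1 ltW // archi_boundP //.
    by rewrite invr_ge0 oppr_ge0 ltW.
  have te : t * e%:R <= - M%:R.
    have : - t * (j * M)%N%:R <= - t * e%:R.
      by rewrite ler_wpM2l ?ler_nat // oppr_ge0 ltW.
    have : M%:R <= - t * j%:R * M%:R by rewrite ler_peMl.
    by rewrite natrM mulrA; lra.
  have QM : Q e <= ((p ^ M)%N%:R)^-1.
    have -> : ((p ^ M)%N%:R)^-1 = (p%:R : rT) `^ (- M%:R).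
      by rewrite powRN powR_mulrn // natrX.
    by rewrite ler_powR // ler1n ltnW.
  apply: (@le_lt_trans _ _ (`|C| * ((p ^ M)%N%:R)^-1)).
    apply: (@le_trans _ _ (`|C| * Q e)); first by rewrite ler_wpM2r ?ler_norm // ltW.
    by rewrite ler_wpM2l.
  rewrite ltr_pdivrMr ?mul1r ?ltr0n ?expn_gt0 1?ltnW //.
  apply: lt_trans (archi_boundP (normr_ge0 C)) _.
  by rewrite ltr_nat ltn_expl.
exists (maxn E E1) => e; rewrite geq_max => /andP[Ee E1e].
have [d [bE dB]] := degree_bound Ee (HE1 _ E1e).
have d0 : d = 0%N by case: dB => //; rewrite (ltr_nat rT d 1) ltnS leqn0 => /eqP.
have [[f [bf lf f0]]|none] := pselect (exists f, [/\ b e f, low 1 f & f <> 0]).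
  left; rewrite JD_ext -loc1; apply: sub_ideal_gen; exists 1 => //.
  move: lf bf f0; rewrite /low/= => /msize1_polyC ->; set c := mcoeff _ _ => bc cn.
  have c0 : c != 0 by apply/eqP => E0; apply: cn; rewrite E0 mpolyC0.
  have := ideal_scale c^-1 (graded_ideal (gb e)) bc.
  by rewrite -mul_mpolyC -mpolyCM mulVf.
right; have b0 : b e `<=` [set 0].
  rewrite bE d0; apply: ideal_gen_sub.
    split=> [//|x y -> ->|r x ->]; first by rewrite /= addr0.
    by rewrite /= mulr0.
  by move=> f [bf lf] /=; apply: contrapT => f0; apply: none; exists f.
have JD0 s : JD e s -> s = 0.
  rewrite JD_ext => -[m [r [s' [bs ->]]]]; rewrite big1 // => i _.
  by have [f /b0 -> <-] := bs i; rewrite loc0 mulr0.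
move=> f; case: (JD_fedder e) => _ _ _ <- [s /JD0 -> fE] /=.
apply/funext => x; have [u ->] := quot_pi_surj x.
by rewrite fE mul0r (hom_frob0 (Tr_gen e).1) quot_pi0.
Qed.

End FedderData.

Theorem theorem3p9 (rT : realType) (p n : nat) (k : fieldType)
  (char_k : p \in [pchar k]) (k_Ffin : F_finite p k)
  (J : set (mpoly.mpoly n k)) (J_homog : homogeneous_ideal J)
  (D : nat -> set (quotient_local_ring J -> quotient_local_ring J))
  (D_cartier : cartier_subalgebra p D)
  (Tr : nat -> local_ring n k -> local_ring n k)
  (Tr_gen : forall e, frob_generator p e (Tr e))
  (JD : nat -> set (local_ring n k))
  (JD_fedder : forall e, fedder_ideal p e (Tr e) (D e) (JD e))
  (b : nat -> set (mpoly.mpoly n k))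
  (b_homog : forall e, homogeneous_ideal (b e))
  (JD_ext : forall e, JD e = extension (b e))
  (t : rT)
  (d_bigO : exists C : rT, \forall e \near \oo,
     (gen_degree rT (b e) <= (C * p%:R `^ (t * e%:R))%:E)%E) :
  (frob_exponent p rT D <= t%:E * krull_dim (quotient_local_ring J) rT)%E.
Proof.
have p_prime : prime p := pcharf_prime char_k.
have gJ := homogeneous_graded J_homog.
have gb e := homogeneous_graded (b_homog e).
have J1 := fedder_proper D_cartier.
have [d [H0 [c [chain growth]]]] := proper_graded_growth gJ J1.
have dim_ge := krull_dim_ge rT chain.
have [C [E _ HE]] := d_bigO.
have d_bound e : (E <= e)%N -> (gen_degree rT (b e) <= (C * p%:R `^ (t * e%:R))%:E)%E.
  exact: HE.
have D_fin := extends_finite gJ D_cartier Tr_gen JD_fedder gb JD_ext.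
have dim_t : 0 <= t -> ((t * d%:R)%:E <= t%:E * krull_dim (quotient_local_ring J) rT)%E.
  by move=> t0; rewrite EFinM lee_wpmul2l.
have [Jn|J0] := pselect (exists2 h, J h & h <> 0).
  have t0 : 0 <= t.
    exact: (t_ge0 char_k gJ D_cartier JD_fedder gb JD_ext d_bound Jn).
  apply: le_trans (dim_t t0); apply: (frob_exponent_le (E := maxn E 2) p_prime D_cartier D_fin) => e Ee.
  exact: (extends_nonzero char_k gJ D_cartier Tr_gen JD_fedder gb JD_ext d_bound growth Jn Ee).
have {}J0 : J `<=` [set 0].
  by move=> h Jh /=; apply: contrapT => h0; apply: J0; exists h.
have [t0|t0] := leP 0 t.
  apply: le_trans (dim_t t0); apply: (frob_exponent_le (E := E.+1) p_prime D_cartier D_fin) => e Ee.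
  exact: (extends_zero char_k gJ D_cartier Tr_gen JD_fedder gb JD_ext d_bound growth J0 t0 Ee).
have [E' HE'] := eventually_trivial char_k Tr_gen JD_fedder gb JD_ext d_bound J0 t0.
have [M HM] := eventually_generated char_k k_Ffin D_cartier Tr_gen JD_fedder HE'.
by rewrite (frob_exponent_Ny rT p_prime D_cartier D_fin HM) leNye.
Qed.
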